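(* Let $\mu,\nu$ be partitions, and let $X=(x_i)$, $Y=(y_j)$, $W=(w_k)$, $Z=(z_\ell)$ be finite lists of variables. Then, as formal power series in these variables, $$\sum_{\lambda}F_{\lambda/\mu}(X/Y;q)\,G_{\lambda/\nu}(W/Z;q)=\Omega\cdot\sum_{\lambda}F_{\nu/\lambda}(X/Y;q)\,G_{\mu/\lambda}(W/Z;q),$$ where both sums run over all partitions $\lambda$ and $$\Omega=\prod_{i,k}\mathsf H(x_iw_k)\ \prod_{j,\ell}\mathsf H(y_jz_\ell)\ \prod_{i,\ell}\mathsf E(-x_iz_\ell)\ \prod_{j,k}\mathsf E(-y_jw_k),\qquad \mathsf H(t)=\sum_{m\ge0}\kappa(h_m)t^m,\quad \mathsf E(t)=\sum_{m\ge0}\kappa(e_m)t^m.$$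
   Context: Fix $n\ge1$ and a formal parameter $q$. Let $a_k=\frac{1-q^{2nk}}{1-q^{2k}}=1+q^{2k}+\cdots+q^{2k(n-1)}$ for $k\ge1$. The Heisenberg algebra $H$ is the associative unital algebra over $\mathbb C(q)$ generated by $\{B_k:k\in\mathbb Z\setminus\{0\}\}$ with relations $[B_j,B_k]=j\,a_{|k|}\,\delta_{j,-k}$. For a partition $\lambda$ put $B_{\pm\lambda}=B_{\pm\lambda_1}B_{\pm\lambda_2}\cdots B_{\pm\lambda_{\ell(\lambda)}}$ and $z_\lambda=\prod_i i^{m_i(\lambda)}m_i(\lambda)!$, with $m_i(\lambda)$ the number of parts equal to $i$. For $k\ge0$ set $$D_k=\sum_{\lambda\vdash k}z_\lambda^{-1}B_\lambda,\quad \widetilde D_k=(-1)^k\sum_{\lambda\vdash k}(-1)^{\ell(\lambda)}z_\lambda^{-1}B_\lambda,\quad U_k=\sum_{\lambda\vdash k}z_\lambda^{-1}B_{-\lambda},\quad \widetilde U_k=(-1)^k\sum_{\lambda\vdash k}(-1)^{\ell(\lambda)}z_\lambda^{-1}B_{-\lambda}.$$ The Fock space $\boldsymbol F$ has basis $|\lambda\rangle$ indexed by all partitions, with bilinear form $\langle\lambda,\mu\rangle=\delta_{\lambda\mu}$. It carries the Lascoux–Leclerc–Thibon representation of $H$, in which $B_k$ and $B_{-k}$ are adjoint to each other, and in which $U_k$ adds horizontal $n$-ribbon strips: $U_k\cdot|\mu\rangle=\sum_\lambda q^{\operatorname{spin}(\lambda/\mu)}|\lambda\rangle$, over all $\lambda\supset\mu$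 such that $\lambda/\mu$ admits a tiling that is a horizontal $n$-ribbon strip with $k$ ribbons, $\operatorname{spin}(\lambda/\mu)$ being the total spin of that tiling. (These two properties determine the action; that the relations of $H$ hold is a known theorem.) Here an $n$-ribbon is a connected skew shape with $n$ boxes and no $2\times2$ square, its spin is its number of rows minus one, and a tiling of a skew shape by $n$-ribbons is a horizontal $n$-ribbon strip if the top-right-most square of each ribbon touches the northern boundary of the shape (rows of Young diagrams are drawn from top to bottom, left-justified). For $X=(x_1,\dots,x_l)$ and $Y=(y_1,\dots,y_m)$ define $$F_{\lambda/\mu}(X/Y;q)=\sum_{\alpha,\beta}X^\alpha(-Y)^\beta\langle U_{\alpha_l}\cdots U_{\alpha_1}\widetilde U_{\beta_m}\cdots\widetilde U_{\beta_1}\cdot\mu,\lambda\rangle,$$ $$G_{\lambda/\mu}(X/Y;q)=\sum_{\alpha,\beta}X^\alpha(-Y)^\beta\langle D_{\alpha_l}\cdots D_{\alpha_1}\widetilde D_{\beta_m}\cdots\widetilde D_{\beta_1}\cdot\lambda,\mu\rangle,$$ the sums running over all compositions $\alpha\in\mathbb Z_{\ge0}^l$, $\beta\in\mathbb Z_{\ge0}^m$, with $X^\alpha=\prod x_i^{\alpha_i}$ and $(-Y)^\beta=\prod(-y_j)^{\beta_j}$. These are defined for all pairs of partitions (and may be zero). Finally $h_k,e_k,p_k$ are the complete homogeneous, elementary and power-sum symmetric functions, and $\kappa:\Lambda\to\mathbb C(q)$ is the algebra homomorphism from the ring of symmetric functions (with coefficients in $\mathbb C(q)$) with $\kappa(p_k)=a_k$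 for $k\ge1$. *)

(* Defs.v *)
From HB Require Import structures.
From mathcomp Require Import all_boot all_order all_algebra finmap.
From mathcomp Require Import fraction complex.
From mathcomp Require Import boolp classical_sets functions cardinality fsbigop.
From mathcomp Require Import reals.
From mathcomp Require Import monalg.

Set Implicit Arguments.
Unset Strict Implicit.
Unset Printing Implicit Defensive.

Import GRing.Theory.

Local Open Scope classical_set_scope.
Local Open Scope ring_scope.

Local Notation "1" := (@mone _) : monom_scope.
Local Notation "x * y" := (mmul x y) : monom_scope.

(* Formal power series in a possibly infinite set [I] of variables; a monomial
   is a finitely supported exponent vector. *)

Record fps (I : choiceType) (R : Type) := Fps { fps_coef : {cmonom I} -> R }.
Coercion fps_coef : fps >-> Funclass.

Section FpsRing.
Context {I : choiceType} {R : comNzRingType}.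
Local Notation M := {cmonom I}.
Local Notation S := (fps I R).
Implicit Types (f g h : S) (m : M).

Lemma fpsP f g : f =1 g -> f = g.
Proof. by case: f g => [f] [g] /= /funext ->. Qed.

HB.instance Definition _ := gen_eqMixin S.
HB.instance Definition _ := gen_choiceMixin S.

Definition fps0 : S := Fps (fun=> 0).
Definition fps_opp f : S := Fps (fun m => - f m).
Definition fps_add f g : S := Fps (fun m => f m + g m).
Definition fps_scale (a : R) f : S := Fps (fun m => a * f m).
Definition fps1 : S := Fps (fun m => (m == 1%M)%:R).

Definition factorizations m : set (M * M) := [set p | (p.1 * p.2)%M = m].

Definition fps_mul f g : S :=
  Fps (fun m => \sum_(p \in factorizations m) f p.1 * g p.2).

Fact fps_addA : associative fps_add.
Proof. by move=> f g h; apply: fpsP => m /=; rewrite addrA. Qed.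
Fact fps_addC : commutative fps_add.
Proof. by move=> f g; apply: fpsP => m /=; rewrite addrC. Qed.
Fact fps_add0 : left_id fps0 fps_add.
Proof. by move=> f; apply: fpsP => m /=; rewrite add0r. Qed.
Fact fps_addN : left_inverse fps0 fps_opp fps_add.
Proof. by move=> f; apply: fpsP => m /=; rewrite addNr. Qed.

HB.instance Definition _ :=
  GRing.isZmodule.Build S fps_addA fps_addC fps_add0 fps_addN.

Lemma fpsDE f g m : (f + g) m = f m + g m. Proof. by []. Qed.

Fact fps_scaleA a b f : fps_scale a (fps_scale b f) = fps_scale (a * b) f.
Proof. by apply: fpsP => m /=; rewrite mulrA. Qed.
Fact fps_scale1 : left_id 1 fps_scale.
Proof. by move=> f; apply: fpsP => m /=; rewrite mul1r. Qed.
Fact fps_scaleDr : right_distributive fps_scale +%R.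
Proof. by move=> a f g; apply: fpsP => m /=; rewrite mulrDr. Qed.
Fact fps_scaleDl f : {morph fps_scale^~ f : a b / a + b}.
Proof. by move=> a b; apply: fpsP => m /=; rewrite mulrDl. Qed.

HB.instance Definition _ := GRing.Zmodule_isLmodule.Build R S
  fps_scaleA fps_scale1 fps_scaleDr fps_scaleDl.

Lemma fpsZE a f m : (a *: f) m = a * f m. Proof. by []. Qed.

Lemma finite_divisors m : finite_set [set d : M | forall i, (d i <= m i)%N].
Proof.
pose D := finsupp m; pose N := (\max_(i <- D) m i)%N.
pose F (u : {ffun D -> 'I_N.+1}) : M :=
  mkcmonom [fsfun i : D => nat_of_ord (u i) | 0%N]%fset.
apply: (@sub_finite_set _ _ (F @` setT)); last exact/finite_image/finite_finset.
move=> d /= le_dm.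
have leN (i : D) : (d (val i) < N.+1)%N.
  rewrite ltnS (leq_trans (le_dm _)) // /N.
  by rewrite (big_rem (val i)) //= ?leq_maxl //; apply: valP.
exists [ffun i => Ordinal (leN i)] => //.
apply/eqP/cmP => i; rewrite /F cmE /= fsfun_ffun.
case: insubP => [u _ <-|iD]; first by rewrite /= ffunE.
by apply/esym/eqP; rewrite -leqn0 (leq_trans (le_dm i)) // leqn0 cmE_eq0.
Qed.

Lemma finite_factorizations m : finite_set (factorizations m).
Proof.
apply: (@sub_finite_set _ _ ([set d : M | forall i, (d i <= m i)%N] `*`
  [set d : M | forall i, (d i <= m i)%N])); last first.
  by apply: finite_setX; apply: finite_divisors.
by move=> [a b] /= <-; split=> i /=; rewrite cmM ?leq_addr ?leq_addl.
Qed.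

Lemma fps_mulE f g m :
  fps_mul f g m = \sum_(p <- fset_set (factorizations m)) f p.1 * g p.2.
Proof. by rewrite /= fsbig_finite //=; apply: finite_factorizations. Qed.

Lemma factorizationsP m (p : M * M) :
  (p \in fset_set (factorizations m)) = ((p.1 * p.2)%M == m).
Proof.
rewrite in_fset_set; last exact: finite_factorizations.
by apply/idP/eqP => [/set_mem|?]; last exact/mem_set.
Qed.

Fact fps_mulC : commutative fps_mul.
Proof.
move=> f g; apply: fpsP => m; rewrite !fps_mulE.
pose sw (p : M * M) := (p.2, p.1).
have swK : cancel sw sw by case.
rewrite -(big_map sw xpredT (fun p => f p.2 * g p.1)) /=.
rewrite (perm_big (fset_set (factorizations m))) /=; last first.
  apply: uniq_perm; rewrite ?fset_uniq ?map_inj_uniq ?fset_uniq //.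
    exact: can_inj swK.
  move=> p; rewrite -{1}(swK p) mem_map; last exact: can_inj swK.
  by rewrite !factorizationsP mulmC.
by apply: eq_bigr => p _; rewrite mulrC.
Qed.

Fact fps_mul1 : left_id fps1 fps_mul.
Proof.
move=> f; apply: fpsP => m; rewrite fps_mulE.
rewrite (big_rem (1%M, m)) /=; last by rewrite factorizationsP mul1m.
rewrite eqxx mul1r big_seq big1 ?addr0 // => p.
rewrite mem_rem_uniq ?fset_uniq // inE factorizationsP => /andP[neq /eqP pm].
have [p1|_] := eqVneq p.1 1%M; last by rewrite mul0r.
by case: p p1 pm neq => a b /= -> <-; rewrite mul1m eqxx.
Qed.

Fact fps_mulDl : left_distributive fps_mul +%R.
Proof.
move=> f g h; apply: fpsP => m.
rewrite fpsDE !fps_mulE -big_split /=.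
by apply: eq_bigr => p _; rewrite mulrDl.
Qed.

Fact fps_mulA : associative fps_mul.
Proof.
move=> f g h; apply: fpsP => m; rewrite !fps_mulE.
pose fac d : seq (M * M) := fset_set (factorizations d).
pose s1 := [seq (p.1, (r.1, r.2)) | p <- fac m, r <- fac p.2].
pose s2 := [seq (r.1, (r.2, p.2)) | p <- fac m, r <- fac p.1].
have uniq_s1 : uniq s1.
  apply: allpairs_uniq_dep => [|p _|]; rewrite ?fset_uniq //.
  move=> u v /allpairsPdep[p [r [pP rP ->]]] /allpairsPdep[p' [r' [pP' rP' ->]]].
  move=> /= [e1 e2 e3]; move: rP rP'; rewrite !factorizationsP => /eqP q /eqP q'.
  case: p p' r r' e1 e2 e3 q q' {pP pP'} => [a b] [a' b'] [c d] [c' d'] /=.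
  by move=> -> -> -> -> ->.
have uniq_s2 : uniq s2.
  apply: allpairs_uniq_dep => [|p _|]; rewrite ?fset_uniq //.
  move=> u v /allpairsPdep[p [r [pP rP ->]]] /allpairsPdep[p' [r' [pP' rP' ->]]].
  move=> /= [e1 e2 e3]; move: rP rP'; rewrite !factorizationsP => /eqP q /eqP q'.
  case: p p' r r' e1 e2 e3 q q' {pP pP'} => [a b] [a' b'] [c d] [c' d'] /=.
  by move=> -> -> -> -> ->.
have eq_s : perm_eq s1 s2.
  apply: uniq_perm => // -[a [b c]]; apply/allpairsPdep/allpairsPdep.
  - move=> [p [r [+ + [-> -> ->]]]]; rewrite !factorizationsP => /eqP pm /eqP rp.
    exists ((p.1 * r.1)%M, r.2), (p.1, r.1); split=> //.
      by rewrite factorizationsP /= -mulmA rp pm.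
    by rewrite factorizationsP.
  - move=> [p [r [+ + [-> -> ->]]]]; rewrite !factorizationsP => /eqP pm /eqP rp.
    exists (r.1, (r.2 * p.2)%M), (r.2, p.2); split=> //.
      by rewrite factorizationsP /= mulmA rp pm.
    by rewrite factorizationsP.
transitivity (\sum_(t <- s1) f t.1 * g t.2.1 * h t.2.2).
  rewrite big_allpairs_dep; apply: eq_bigr => p _.
  by rewrite fps_mulE mulr_sumr; apply: eq_bigr => r _; rewrite mulrA.
rewrite (perm_big s2) // big_allpairs_dep; apply: eq_bigr => p _.
by rewrite fps_mulE mulr_suml.
Qed.

Fact fps1_neq0 : fps1 != 0 :> S.
Proof.
apply/eqP => /(congr1 (fun f : S => f 1%M)) /= /eqP.
by rewrite eqxx oner_eq0.
Qed.

HB.instance Definition _ := GRing.Zmodule_isComNzRing.Build S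
  fps_mulA fps_mulC fps_mul1 fps_mulDl fps1_neq0.

Lemma fpsME f g m :
  (f * g) m = \sum_(p <- fset_set (factorizations m)) f p.1 * g p.2.
Proof. exact: fps_mulE. Qed.

Fact fps_scaleAl (a : R) f g : a *: (f * g) = a *: f * g.
Proof.
apply: fpsP => m; rewrite fpsZE !fpsME mulr_sumr.
by apply: eq_bigr => p _; rewrite fpsZE mulrA.
Qed.

HB.instance Definition _ := GRing.Lmodule_isLalgebra.Build R S fps_scaleAl.
HB.instance Definition _ := GRing.Lalgebra_isComAlgebra.Build R S.

Definition fps_var (i : I) : S := Fps (fun m => (m == ucm i)%:R).

Definition fps_summable (J : choiceType) (f : J -> S) :=
  forall m, finite_set [set j | f j m != 0].

(* Coefficientwise sum, meaningful for summable families only. *)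
Definition fps_sum (J : choiceType) (f : J -> S) : S :=
  Fps (fun m => \sum_(j \in setT) f j m).

End FpsRing.

(* Symmetric functions are the symmetric series of bounded degree in the
   variables indexed by [nat]. *)

Section SymmetricFunctions.
Context {R : comNzRingType}.
Local Notation M := {cmonom nat}.
Local Notation S := (fps nat R).
Implicit Types (f g : S) (m : M).

Definition same_orbit m m' :=
  exists2 s : nat -> nat, bijective s & forall i, m' i = m (s i).

Definition fps_symmetric f := forall m m', same_orbit m m' -> f m = f m'.

Definition fps_bounded f :=
  exists d : nat, forall m, f m != 0 -> (mdeg m <= d)%N.

Definition is_symfun : pred S := fun f => `[< fps_symmetric f /\ fps_bounded f >].

Lemma relabel_subproof (s : nat -> nat) : bijective s ->
  exists F : M -> M, [/\ bijective F, forall m i, F m i = m (s i) &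
    {morph F : a b / (a * b)%M}].
Proof.
have mk (s1 s2 : nat -> nat) : cancel s1 s2 -> cancel s2 s1 ->
    {F : M -> M | forall m i, F m i = m (s1 i)}.
  move=> K1 K2.
  exists (fun m => mkcmonom
    [fsfun i in [fset s2 i | i in finsupp m]%fset => m (s1 i) | 0%N]).
  move=> m i; rewrite cmE /= fsfun_fun.
  case: ifPn => // /imfsetP mi; apply/esym/eqP; rewrite cmE_eq0.
  by apply/negP => si; apply: mi; exists (s1 i); rewrite ?K1.
case=> s' K1 K2; have [F HF] := mk _ _ K1 K2; have [G HG] := mk _ _ K2 K1.
exists F; split=> // [|a b].
  by exists G => m; apply/eqP/cmP => i; rewrite ?HF ?HG ?HF ?K1 ?K2.
by apply/eqP/cmP => i; rewrite cmM !HF cmM.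
Qed.

Lemma is_symfunP f : reflect (fps_symmetric f /\ fps_bounded f) (f \in is_symfun).
Proof. exact: asboolP. Qed.

Lemma symfun_subalg_closed : GRing.subalg_closed is_symfun.
Proof.
split=> [|a f g /is_symfunP[fS [d fd]] /is_symfunP[gS [e ge]]|f g].
- apply/is_symfunP; split=> [m m' [s [s' K1 K2] mm']|].
    congr (nat_of_bool _)%:R; apply/eqP/eqP => [e|e]; apply/eqP/cmP => i.
      by rewrite mm' e !cm1.
    by rewrite -(K2 i) -mm' e !cm1.
  exists 0%N => m /=; have [->|_] := eqVneq m 1%M; first by rewrite mdeg1.
  by rewrite eqxx.
- apply/is_symfunP; split=> [m m' mm'|].
    by rewrite !fpsDE !fpsZE (fS _ _ mm') (gS _ _ mm').
  exists (maxn d e) => m; rewrite fpsDE fpsZE leq_max.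
  have [/eqP|/fd ->//] := boolP (f m == 0); have [/eqP|/ge ->] := boolP (g m == 0).
    by move=> -> ->; rewrite mulr0 addr0 eqxx.
  by rewrite orbT.
- move=> /is_symfunP[fS [d fd]] /is_symfunP[gS [e ge]]; apply/is_symfunP.
  split=> [m m' [s sbij mm']|].
    have [F [[G FK GK] FE FM]] := relabel_subproof sbij.
    have Fm : F m = m' by apply/eqP/cmP => i; rewrite FE mm'.
    rewrite !fpsME.
    pose FF (p : M * M) := (F p.1, F p.2).
    have FFinj : injective FF.
      by move=> [a b] [a' b'] [/(can_inj FK) -> /(can_inj FK) ->].
    rewrite [RHS](perm_big [seq FF p | p <- fset_set (factorizations m)]) /=.
      rewrite big_map; apply: eq_bigr => p _; congr (_ * _).
        by apply: fS; exists s => // i; rewrite FE.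
      by apply: gS; exists s => // i; rewrite FE.
    apply: uniq_perm; rewrite ?fset_uniq ?map_inj_uniq ?fset_uniq //.
    move=> p; have -> : p = FF (G p.1, G p.2) by case: p => ? ?; rewrite /FF /= !GK.
    rewrite mem_map // !factorizationsP /= -FM -Fm.
    by rewrite (inj_eq (can_inj FK)).
  exists (d + e)%N => m; rewrite fpsME.
  apply: contraNT; rewrite -ltnNge => dm; apply/eqP; rewrite big_seq big1 // => p.
  rewrite factorizationsP => /eqP pm; move: dm; rewrite -pm mdegM => dm.
  have [->|/fd fp] := eqVneq (f p.1) 0; first by rewrite mul0r.
  have [->|/ge gp] := eqVneq (g p.2) 0; first by rewrite mulr0.
  by move: dm; rewrite ltnNge leq_add.
Qed.

HB.instance Definition _ :=
  GRing.isSubalgClosed.Build R S is_symfun symfun_subalg_closed.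

End SymmetricFunctions.

Record symfun (R : comNzRingType) :=
  Symfun { symfun_val :> fps nat R; symfunP : symfun_val \in is_symfun }.
Arguments Symfun {R}.

Section SymfunRing.
Context {R : comNzRingType}.

HB.instance Definition _ := [isSub for @symfun_val R].
HB.instance Definition _ := [Choice of symfun R by <:].
HB.instance Definition _ := [SubChoice_isSubComNzRing of symfun R by <:].
HB.instance Definition _ := GRing.SubZmodule_isSubLmodule.Build R (fps nat R) _
  (symfun R) (GRing.subsemimodClosedP _).
HB.instance Definition _ := GRing.SubNzRing_SubLmodule_isSubLalgebra.Build R
  (fps nat R) _ (symfun R).
HB.instance Definition _ := GRing.SubLalgebra_isSubAlgebra.Build R (fps nat R) _
  (symfun R).

Lemma same_orbit_mdeg (m m' : {cmonom nat}) : same_orbit m m' -> mdeg m = mdeg m'.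
Proof.
move=> [s [s' K1 K2] mm']; rewrite !mdegE.
rewrite (perm_big [seq s i | i <- finsupp m']) /=; last first.
  apply: uniq_perm; rewrite ?fset_uniq ?(map_inj_uniq (can_inj K1)) ?fset_uniq //.
  move=> i; rewrite -[in RHS](K2 i) (mem_map (can_inj K1)) -!cmE_neq0 mm'.
  by rewrite K2.
by rewrite big_map; apply: eq_bigr => i _; rewrite mm'.
Qed.

(* The sum of the monomials of degree [k] satisfying [P]. *)
Definition monomial_sum (k : nat) (P : {cmonom nat} -> Prop) : fps nat R :=
  Fps (fun m => ((mdeg m == k) && `[< P m >])%:R).

Lemma monomial_sum_symfun k (P : {cmonom nat} -> Prop) :
  (forall m m', same_orbit m m' -> P m <-> P m') ->
  monomial_sum k P \in is_symfun.
Proof.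
move=> PP; apply/is_symfunP; split=> [m m' mm'|].
  by rewrite /= (same_orbit_mdeg mm') (asbool_equiv_eq (PP _ _ mm')).
by exists k => m /=; have [->|_] := eqVneq (mdeg m) k; rewrite //= eqxx.
Qed.

Fact hsym_subproof k : monomial_sum k (fun=> True) \in is_symfun.
Proof. exact: monomial_sum_symfun. Qed.

Fact esym_subproof k :
  monomial_sum k (fun m => forall i, (m i <= 1)%N) \in is_symfun.
Proof.
apply: monomial_sum_symfun => m m' [s [s' _ K2] mm'].
by split=> P i; [rewrite mm' | rewrite -(K2 i) -mm'].
Qed.

Fact psum_subproof k :
  monomial_sum k (fun m => exists i, forall j, m j = (k * (j == i))%N)
    \in is_symfun.
Proof.
apply: monomial_sum_symfun => m m' [s [s' K1 K2] mm']; split=> -[i Pi].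
  by exists (s' i) => j; rewrite mm' Pi (can2_eq K1 K2).
by exists (s i) => j; rewrite -(K2 j) -mm' Pi (inj_eq (can_inj K1)).
Qed.

Definition hsym k := Symfun _ (hsym_subproof k).
Definition esym k := Symfun _ (esym_subproof k).
(* [psum k] is the power sum for [k > 0] only. *)
Definition psum k := Symfun _ (psum_subproof k).

End SymfunRing.
Arguments hsym : clear implicits.
Arguments esym : clear implicits.
Arguments psum : clear implicits.

Record intpart := IntPart {
  parts :> seq nat;
  partsP : sorted geq parts && (0%N \notin parts) }.

HB.instance Definition _ := [isSub for parts].
HB.instance Definition _ := [Countable of intpart by <:].

Definition zpart (la : seq nat) : nat :=
  (\prod_(i <- undup la) (i ^ count_mem i la * (count_mem i la)`!))%N.

(* Boxes are pairs (row, column), numbered from 0, rows going downwards. *)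
Definition box : Type := (nat * nat)%type.

Definition diagram (la : seq nat) : {fset box} :=
  [fset b in [seq (i, j) | i <- iota 0 (size la), j <- iota 0 (nth 0 la i)]]%fset.

Definition skew (la mu : intpart) : {fset box} :=
  (diagram la `\` diagram mu)%fset.

Definition skew_shape (S : {fset box}) : Prop :=
  exists la mu : intpart, (diagram mu `<=` diagram la)%fset /\ S = skew la mu.

Definition adjacent (b c : box) : bool :=
  (b.1 == c.1) && ((b.2 == c.2.+1) || (c.2 == b.2.+1))
  || (b.2 == c.2) && ((b.1 == c.1.+1) || (c.1 == b.1.+1)).

Definition connected_shape (S : {fset box}) : Prop :=
  forall b c, b \in S -> c \in S ->
    exists p : seq box, [/\ path adjacent b p, {subset p <= S} & last b p = c].

Definition has_square (S : {fset box}) : Prop :=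
  exists i j, [/\ (i, j) \in S, (i, j.+1) \in S, (i.+1, j) \in S
                & (i.+1, j.+1) \in S].

Definition is_ribbon (n : nat) (S : {fset box}) : Prop :=
  [/\ skew_shape S, connected_shape S, #|` S| = n & ~ has_square S].

Definition ribbon_spin (S : {fset box}) : nat :=
  (#|` [fset b.1 | b in S]%fset|).-1.

Definition top_right (S : {fset box}) (b : box) : Prop :=
  b \in S /\ forall c, c \in S -> (b.1 <= c.1)%N /\ (c.2 <= b.2)%N.

Definition touches_north (shape : {fset box}) (b : box) : Prop :=
  forall i, b.1 = i.+1 -> (i, b.2) \notin shape.

Definition ribbon_tiling (n : nat) (shape : {fset box}) (T : {fset {fset box}}) :=
  [/\ forall S, S \in T -> is_ribbon n S, trivIfset T & fcover T = shape].

Definition horizontal_strip (n : nat) (shape : {fset box}) (T : {fset {fset box}}) :=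
  ribbon_tiling n shape T /\
  forall S, S \in T -> exists b, top_right S b /\ touches_north shape b.

Definition tiling_spin (T : {fset {fset box}}) : nat :=
  (\sum_(S <- T) ribbon_spin S)%N.

Section FockSpace.
Context {K : fieldType}.

Definition fock : lmodType K := {malg K[intpart]}.
Implicit Types (v w : fock) (la mu : intpart).

Definition ket la : fock := << 1 *g la >>.

Definition bracket v w : K := \sum_(la <- msupp v) v@_la * w@_la.

(* Power-sum expansions of h_k and e_k, with p_i replaced by the operator [b i]. *)
Definition part_op (b : nat -> fock -> fock) la v : fock := foldr b v la.

Definition complete_op (b : nat -> fock -> fock) (k : nat) v : fock :=
  \sum_(la \in [set la : intpart | sumn la = k])
    (zpart la)%:R^-1 *: part_op b la v.

Definition elementary_op (b : nat -> fock -> fock) (k : nat) v : fock :=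
  (-1) ^+ k *: \sum_(la \in [set la : intpart | sumn la = k])
    ((-1) ^+ size la * (zpart la)%:R^-1) *: part_op b la v.

Definition heis_coef (q : K) (n k : nat) : K :=
  (1 - q ^+ (2 * n * k)) / (1 - q ^+ (2 * k)).

Section Operators.
Variable B : int -> {linear fock -> fock}.

Definition D_op := complete_op (fun i => B i%:Z).
Definition Dt_op := elementary_op (fun i => B i%:Z).
Definition U_op := complete_op (fun i => B (- i%:Z)).
Definition Ut_op := elementary_op (fun i => B (- i%:Z)).

(* A representation of the Heisenberg algebra is a family [B] of operators
   satisfying its defining relations; [B 0] is irrelevant. A horizontal strip
   tiling of a given skew shape is unique, so the last two fields determine
   the matrix of [U_op k]. *)
Record LLT_representation (q : K) (n : nat) : Prop := {
  heisenberg_relation : forall j k v, j != 0 -> k != 0 ->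
    B j (B k v) - B k (B j v) =
    (j%:~R * heis_coef q n `|k|%N * (j == - k)%:R) *: v;
  adjoint_relation : forall k v w, k != 0 ->
    bracket (B k v) w = bracket v (B (- k) w);
  U_op_strip : forall k la mu T,
    (diagram mu `<=` diagram la)%fset ->
    horizontal_strip n (skew la mu) T -> #|` T| = k ->
    (U_op k (ket mu))@_la = q ^+ tiling_spin T;
  U_op_no_strip : forall k la mu,
    ~ ((diagram mu `<=` diagram la)%fset /\
       exists T, horizontal_strip n (skew la mu) T /\ #|` T| = k) ->
    (U_op k (ket mu))@_la = 0 }.

(* [apply_seq A s v] is [A_{s_l} ... A_{s_1} v]. *)
Definition apply_seq (A : nat -> fock -> fock) (s : seq nat) v : fock :=
  foldl (fun w k => A k w) v s.

Section GeneratingSeries.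
Context {I : choiceType} {l m : nat}.
Variables (la mu : intpart) (X : 'I_l -> fps I K) (Y : 'I_m -> fps I K).

Definition super_monomial (a : l.-tuple nat) (b : m.-tuple nat) : fps I K :=
  (\prod_(i < l) X i ^+ tnth a i) * \prod_(j < m) (- Y j) ^+ tnth b j.

Definition F_series : fps I K :=
  fps_sum (fun ab : l.-tuple nat * m.-tuple nat =>
    bracket (apply_seq U_op ab.1 (apply_seq Ut_op ab.2 (ket mu))) (ket la)
      *: super_monomial ab.1 ab.2).

Definition G_series : fps I K :=
  fps_sum (fun ab : l.-tuple nat * m.-tuple nat =>
    bracket (apply_seq D_op ab.1 (apply_seq Dt_op ab.2 (ket la))) (ket mu)
      *: super_monomial ab.1 ab.2).

End GeneratingSeries.
End Operators.

Section Kernel.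
Context {I : choiceType}.
Variable kappa : symfun K -> K.

Definition H_kernel (t : fps I K) : fps I K :=
  fps_sum (fun m : nat => kappa (hsym K m) *: t ^+ m).

Definition E_kernel (t : fps I K) : fps I K :=
  fps_sum (fun m : nat => kappa (esym K m) *: t ^+ m).

Definition Omega {a b c d : nat} (X : 'I_a -> fps I K) (Y : 'I_b -> fps I K)
    (W : 'I_c -> fps I K) (Z : 'I_d -> fps I K) : fps I K :=
  (\prod_i \prod_k H_kernel (X i * W k)) * (\prod_j \prod_l H_kernel (Y j * Z l))
  * (\prod_i \prod_l E_kernel (- (X i * Z l)))
  * (\prod_j \prod_k E_kernel (- (Y j * W k))).

End Kernel.
End FockSpace.
Arguments fock : clear implicits.

Notation Cq R := {fraction {poly R[i]}}.

Definition q_var (R : realType) : Cq R := tofrac ('X : {poly R[i]}).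

(* Main.v *)
(* The series [F] and [G] are matrix coefficients of products of
   one-variable operator series [A(t) = sum_k A_k t^k], where [A_k] is the
   expression of [h_k] or [e_k] through Heisenberg modes [b_i] in place of power
   sums. Inserting [sum_la |la><la|] turns the left side into
   [<D(W/Z) U(X/Y) mu, nu>] and the sum on the right into
   [<U(X/Y) D(W/Z) mu, nu>], so the theorem says that moving [D(W/Z)] past
   [U(X/Y)] produces the scalar [Omega]. By multiplicativity this is a statement
   about one variable on each side. Newton's identity
   [k A_k = sum_(1 <= i <= k) b_i A_(k-i)] gives
   [[b_j, A_k] = d_j A_(k-j)] and then [C_j A_k = sum_i c_i A_(k-i) C_(j-i)],
   where the [c_i] satisfy the same Newton recurrence driven by [d_i]; this is
   the recurrence of [kappa(h_i)] if the two families are of the same type and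
   of [kappa(e_i)] otherwise. *)

Require Import Defs.
From mathcomp Require Import all_boot all_order all_algebra finmap.
From mathcomp Require Import fraction complex.
From mathcomp Require Import boolp classical_sets functions cardinality fsbigop.
From mathcomp Require Import reals.
From mathcomp Require Import monalg zify ring.

Set Implicit Arguments.
Unset Strict Implicit.
Unset Printing Implicit Defensive.

Import GRing.Theory.

Local Open Scope classical_set_scope.
Local Open Scope ring_scope.

Local Notation "1" := (@mone _) : monom_scope.
Local Notation "x * y" := (mmul x y) : monom_scope.

(** * Operator-valued power series *)

Local Notation facts m := (fset_set (factorizations m)).

(** Both nested sums enumerate the triples with product [m]. The values lie in an arbitrary
    commutative monoid so that the terms may be vectors. *)
Lemma facts_assoc (I : choiceType) (E : nmodType)
    (phi : {cmonom I} -> {cmonom I} -> {cmonom I} -> E) (m : {cmonom I}) :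
  \sum_(p <- facts m) \sum_(r <- facts p.2) phi p.1 r.1 r.2 =
  \sum_(p <- facts m) \sum_(r <- facts p.1) phi r.1 r.2 p.2.
Proof.
pose psi (t : {cmonom I} * ({cmonom I} * {cmonom I})) := phi t.1 t.2.1 t.2.2.
transitivity (\sum_(t <- [seq (p.1, (r.1, r.2)) | p <- facts m, r <- facts p.2])
  psi t); first by rewrite big_allpairs_dep.
transitivity (\sum_(t <- [seq (r.1, (r.2, p.2)) | p <- facts m, r <- facts p.1])
  psi t); last by rewrite big_allpairs_dep.
apply: perm_big; apply: uniq_perm.
- apply: allpairs_uniq_dep => [|p _|]; rewrite ?fset_uniq // => u v.
  move=> /allpairsPdep[[a b] [[c d] [_ rp ->]]].
  move=> /allpairsPdep[[a' b'] [[c' d'] [_ rp' ->]]] /= [e1 e2 e3].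
  move: rp rp'; rewrite !factorizationsP /= => /eqP <- /eqP <-.
  by rewrite e1 e2 e3.
- apply: allpairs_uniq_dep => [|p _|]; rewrite ?fset_uniq // => u v.
  move=> /allpairsPdep[[a b] [[c d] [_ rp ->]]].
  move=> /allpairsPdep[[a' b'] [[c' d'] [_ rp' ->]]] /= [e1 e2 e3].
  move: rp rp'; rewrite !factorizationsP /= => /eqP <- /eqP <-.
  by rewrite e1 e2 e3.
move=> -[a [b c]]; apply/allpairsPdep/allpairsPdep.
- move=> [p [r [+ + [-> -> ->]]]]; rewrite !factorizationsP => /eqP pm /eqP rp.
  by exists ((p.1 * r.1)%M, r.2), (p.1, r.1); rewrite !factorizationsP /= -mulmA rp pm.
- move=> [p [r [+ + [-> -> ->]]]]; rewrite !factorizationsP => /eqP pm /eqP rp.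
  by exists (r.1, (r.2 * p.2)%M), (r.2, p.2); rewrite !factorizationsP /= mulmA rp pm.
Qed.

Lemma facts_swap (I : choiceType) (E : nmodType)
    (phi : {cmonom I} -> {cmonom I} -> E) (m : {cmonom I}) :
  \sum_(p <- facts m) phi p.1 p.2 = \sum_(p <- facts m) phi p.2 p.1.
Proof.
pose sw (p : {cmonom I} * {cmonom I}) := (p.2, p.1).
have swK : involutive sw by case.
rewrite -[RHS](big_map sw xpredT (fun p => phi p.1 p.2)).
apply: perm_big; apply: uniq_perm; rewrite ?(map_inj_uniq (inv_inj swK)) ?fset_uniq //.
by move=> p; rewrite -{2}[p]swK (mem_map (inv_inj swK)) !factorizationsP mulmC.
Qed.

Lemma facts_one (I : choiceType) (E : nmodType)
    (phi : {cmonom I} -> {cmonom I} -> E) (m : {cmonom I}) :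
  (forall a b, a != 1%M -> phi a b = 0) ->
  \sum_(p <- facts m) phi p.1 p.2 = phi 1%M m.
Proof.
move=> phi0; rewrite (big_rem (1%M, m)) /=; last by rewrite factorizationsP mul1m.
rewrite big_seq big1 ?addr0 // => -[a b].
rewrite mem_rem_uniq ?fset_uniq // inE factorizationsP /= => /andP[neq /eqP pm].
have [a1|/phi0//] := eqVneq a 1%M.
by move: neq; rewrite -pm a1 mul1m eqxx.
Qed.

Section OperatorSeries.
Context {K : comNzRingType} {I : choiceType} {E : lmodType K}.
Local Notation M := {cmonom I}.
Local Notation S := (fps I K).

(** Coefficients are bare functions and linearity is the separate predicate [linser], so equality of
    series is extensionality. The product [oconv] composes coefficients; [oscal] embeds scalar
    series. *)
Definition opser := M -> E -> E.
Implicit Types (T : opser) (g h : S).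

Definition linser T := forall m, linear (T m).

Definition oconv T T' : opser :=
  fun m v => \sum_(p <- facts m) T p.1 (T' p.2 v).

Definition oscal g : opser := fun m v => g m *: v.

Lemma opserP T T' : (forall m v, T m v = T' m v) -> T = T'.
Proof. by move=> eqT; apply/funext => m; apply/funext => v. Qed.

Lemma linear_add (f : E -> E) u v : linear f -> f (u + v) = f u + f v.
Proof. by move=> f_lin; rewrite -[u]scale1r f_lin !scale1r. Qed.

Lemma linear_zero (f : E -> E) : linear f -> f 0 = 0.
Proof.
move=> f_lin; have := f_lin (-1) 0 0.
by rewrite !scaleN1r oppr0 addr0 addNr.
Qed.

Lemma linear_raddf_sum (f : E -> E) (J : Type) (r : seq J) (P : pred J)
    (F : J -> E) : linear f ->
  f (\sum_(j <- r | P j) F j) = \sum_(j <- r | P j) f (F j).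
Proof.
move=> f_lin; apply: (big_morph f); last exact: linear_zero.
by move=> u v; apply: linear_add.
Qed.

Lemma linear_scale (f : E -> E) a v : linear f -> f (a *: v) = a *: f v.
Proof.
by move=> f_lin; have := f_lin a v 0; rewrite (linear_zero f_lin) !addr0.
Qed.

Lemma linser_oscal g : linser (oscal g).
Proof.
by move=> m a u v; rewrite /oscal scalerDr !scalerA mulrC.
Qed.

Lemma linser_oconv T T' : linser T -> linser T' -> linser (oconv T T').
Proof.
move=> linT linT' m a u v; rewrite /oconv scaler_sumr -big_split /=.
by apply: eq_bigr => p _; rewrite linT' linT.
Qed.

Lemma oconvA T1 T2 T3 :
  linser T1 -> oconv T1 (oconv T2 T3) = oconv (oconv T1 T2) T3.
Proof.
move=> lin1; apply: opserP => m v; rewrite /oconv.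
rewrite -(facts_assoc (fun a b c => T1 a (T2 b (T3 c v)))).
by apply: eq_bigr => p _; rewrite linear_raddf_sum.
Qed.

(** Scalars pass through linear maps and monomials commute, so scalar series are central. *)
Lemma oconv_scalC g T : linser T -> oconv T (oscal g) = oconv (oscal g) T.
Proof.
move=> linT; apply: opserP => m v; rewrite /oconv /oscal.
rewrite (facts_swap (fun a b => T a (g b *: v))).
by apply: eq_bigr => p _; rewrite linear_scale.
Qed.

Lemma oscalM g h : oscal (g * h) = oconv (oscal g) (oscal h).
Proof.
apply: opserP => m v; rewrite /oconv /oscal fpsME scaler_suml.
by apply: eq_bigr => p _; rewrite scalerA.
Qed.

Lemma oscal1 T : oconv (oscal 1) T = T.
Proof.
apply: opserP => m v; rewrite /oconv /oscal.
rewrite (facts_one _ (phi := fun a b => (1 : S) a *: T b v)) /=.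
  by rewrite eqxx scale1r.
by move=> a b /negPf /= ->; rewrite scale0r.
Qed.

(** Commutation up to a scalar series, in a form where the scalars multiply when either side is a
    product. *)
Definition ocomm T T' g := oconv T T' = oconv (oscal g) (oconv T' T).

Lemma ocomm_scal1l T : linser T -> ocomm (oscal 1) T 1.
Proof. by move=> linT; rewrite /ocomm !oscal1 oconv_scalC // oscal1. Qed.

Lemma ocomm_scal1r T : linser T -> ocomm T (oscal 1) 1.
Proof. by move=> linT; rewrite /ocomm !oscal1 oconv_scalC // oscal1. Qed.

(** [T1 T2 T = g2 T1 T T2 = g1 g2 T T1 T2], by centrality of the scalar series. *)
Lemma ocomm_convl T1 T2 T g1 g2 : linser T1 -> linser T2 -> linser T ->
  ocomm T1 T g1 -> ocomm T2 T g2 -> ocomm (oconv T1 T2) T (g1 * g2).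
Proof.
move=> lin1 lin2 lin c1 c2; rewrite /ocomm -oconvA // c2.
rewrite oconvA // oconv_scalC // -oconvA; last exact: linser_oscal.
rewrite [oconv T1 _]oconvA // c1 mulrC oscalM -!oconvA //; exact: linser_oscal.
Qed.

Lemma ocomm_convr T1 T2 T g1 g2 : linser T1 -> linser T2 -> linser T ->
  ocomm T T1 g1 -> ocomm T T2 g2 -> ocomm T (oconv T1 T2) (g1 * g2).
Proof.
move=> lin1 lin2 lin c1 c2; rewrite /ocomm oconvA // c1.
have lsc g : linser (oscal g) by exact: linser_oscal.
rewrite -oconvA // -oconvA // c2.
by rewrite [oconv T1 (oconv (oscal _) _)]oconvA // oconv_scalC // oscalM -!oconvA.
Qed.

End OperatorSeries.
Arguments opser K I E : clear implicits.

(** * One-variable series *)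

Section Vanishing.
Context {K : comNzRingType} {I : choiceType}.
Local Notation S := (fps I K).
Implicit Types (t f g : S).

(** The filtration by total degree. Order at least 1 means no constant term, which makes the powers
    of a series summable. *)
Definition fps_ordge (k : nat) f := forall m, (mdeg m < k)%N -> f m = 0.

Lemma fps_ordgeM j k f g :
  fps_ordge j f -> fps_ordge k g -> fps_ordge (j + k) (f * g).
Proof.
move=> fj gk m lt_m; rewrite fpsME big_seq big1 // => p.
rewrite factorizationsP => /eqP pm; move: lt_m; rewrite -pm mdegM => lt_p.
have [/fj->|le_j] := ltnP (mdeg p.1) j; first by rewrite mul0r.
by rewrite gk ?mulr0 // -(ltn_add2l j) (leq_ltn_trans _ lt_p) // leq_add2r.
Qed.

Lemma fps_ordgeMl k f g : fps_ordge k f -> fps_ordge k (f * g).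
Proof. by move=> fk; rewrite -[k]addn0; apply: fps_ordgeM. Qed.

Lemma fps_ordgeX k f : fps_ordge 1 f -> fps_ordge k (f ^+ k).
Proof.
move=> f1; elim: k => [//|k IHk].
by rewrite exprS -add1n; apply: fps_ordgeM.
Qed.

Lemma fps_ordge_var i : fps_ordge 1 (fps_var i : S).
Proof.
move=> m; rewrite ltnS leqn0 => /eqP m0 /=.
by case: eqP => // mi; move: m0; rewrite mi mdegU.
Qed.

Lemma fps_ordgeN k f : fps_ordge k f -> fps_ordge k (- f).
Proof. by move=> fk m /fk /= ->; rewrite oppr0. Qed.

(** [t ^+ k] has order at least [k], so terms from [N] on do not reach [m]. The bound [N] is free so
    that several series can share it. *)
Lemma fps_sum_expE (c : nat -> K) t N m : fps_ordge 1 t -> (mdeg m < N)%N ->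
  fps_sum (fun k : nat => c k *: t ^+ k) m = \sum_(k < N) c k * (t ^+ k) m.
Proof.
move=> t1 lt_mN /=; rewrite (fsbigE (index_iota 0 N)) ?iota_uniq //.
  rewrite -(big_mkord xpredT (fun k => c k * (t ^+ k) m)).
  by apply: eq_bigl => k; rewrite in_setT.
move=> k _; rewrite mem_index_iota /= -leqNgt => leNk.
by rewrite (fps_ordgeX t1) ?mulr0 // (leq_trans lt_mN).
Qed.

End Vanishing.

(** * Generating series of a family of operators *)

Section GeneratingOperators.
Context {K : comNzRingType} {I : choiceType} {E : lmodType K}.
Local Notation S := (fps I K).
Implicit Types (A C : nat -> E -> E) (t w x : S).

(* The series [\sum_k A_k t^k]: the truncation at the total degree is exact when
   [t] has no constant term. *)
Definition gen A t : opser K I E :=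
  fun m v => \sum_(k < (mdeg m).+1) (t ^+ k) m *: A k v.

Lemma genE A t N m v : fps_ordge 1 t -> (mdeg m < N)%N ->
  gen A t m v = \sum_(0 <= k < N) (t ^+ k) m *: A k v.
Proof.
move=> t1 lt_mN; rewrite /gen -(big_mkord xpredT (fun k => (t ^+ k) m *: A k v)).
rewrite [RHS](big_cat_nat (n := (mdeg m).+1)) //=.
rewrite [X in _ + X]big_nat [X in _ + X]big1 ?addr0 //.
by move=> k /andP[lt_k _]; rewrite (fps_ordgeX t1) // scale0r.
Qed.

Lemma linser_gen A t : (forall k, linear (A k)) -> linser (gen A t).
Proof.
move=> linA m a u v; rewrite /gen scaler_sumr -big_split /=.
by apply: eq_bigr => k _; rewrite linA scalerDr !scalerA mulrC.
Qed.

Lemma leq_facts (m : {cmonom I}) p : p \in fset_set (factorizations m) ->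
  (mdeg p.1 <= mdeg m)%N /\ (mdeg p.2 <= mdeg m)%N.
Proof. by rewrite factorizationsP => /eqP <-; rewrite mdegM leq_addr leq_addl. Qed.

Lemma oconv_genE A C w x N m v : fps_ordge 1 w -> fps_ordge 1 x ->
  (forall k, linear (C k)) -> (mdeg m < N)%N ->
  oconv (gen C w) (gen A x) m v =
  \sum_(0 <= j < N) \sum_(0 <= k < N) (w ^+ j * x ^+ k) m *: C j (A k v).
Proof.
move=> w1 x1 linC lt_mN; rewrite /oconv big_seq.
under eq_bigr => p /leq_facts[le1 le2].
  rewrite !(@genE _ _ N) ?(leq_ltn_trans _ lt_mN) //.
  under eq_bigr do rewrite linear_raddf_sum // scaler_sumr.
  over.
rewrite -big_seq exchange_big; apply: eq_bigr => j _ /=.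
rewrite exchange_big; apply: eq_bigr => k _.
rewrite fsbig_finite ?scaler_suml; last exact: finite_factorizations.
apply: eq_bigr => p _.
by rewrite linear_scale // scalerA.
Qed.

Lemma sum_nat_shift (E' : nmodType) i N (F : nat -> E') :
  (forall j, (N <= j)%N -> F j = 0) ->
  \sum_(0 <= j < N | (i <= j)%N) F j = \sum_(0 <= j < N) F (j + i)%N.
Proof.
move=> F0; transitivity (\sum_(0 + i <= j < N) F j).
  by rewrite [RHS](big_nat_widenl _ 0).
rewrite big_addn.
rewrite [RHS](big_cat_nat (n := N - i)) ?leq_subr //=.
rewrite [X in _ + X]big_nat [X in _ + X]big1 ?addr0 // => j.
by rewrite leq_subLR addnC => /andP[/F0].
Qed.

(** Multiply the coefficient relation by [w ^+ j * x ^+ k] and sum. Shifting [j] and [k] by [i]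
    pulls out [(x * w) ^+ i] and leaves the product in the opposite order. *)
Lemma ocomm_gen A C (c : nat -> K) w x :
    fps_ordge 1 w -> fps_ordge 1 x ->
    (forall k, linear (A k)) -> (forall k, linear (C k)) ->
    (forall j k v, C j (A k v) = \sum_(0 <= i < (minn j k).+1)
       c i *: A (k - i)%N (C (j - i)%N v)) ->
  ocomm (gen C w) (gen A x) (fps_sum (fun k : nat => c k *: (x * w) ^+ k)).
Proof.
move=> w1 x1 linA linC CA; apply: opserP => m v.
pose N := (mdeg m).+1; pose V k j := A k (C j v).
have xw1 : fps_ordge 1 (x * w) by exact: fps_ordgeMl.
(* Both sides reduce to this triple sum with all indices below [N]; the right side is treated
   first. *)
transitivity (\sum_(0 <= i < N) \sum_(0 <= j < N) \sum_(0 <= k < N)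
   (c i * ((x * w) ^+ i * (x ^+ k * w ^+ j)) m) *: V k j); last first.
  rewrite [RHS]/oconv [RHS]big_seq.
  under [RHS]eq_bigr => p /leq_facts[le1 le2].
    rewrite (@oconv_genE _ _ _ _ N) // /oscal (@fps_sum_expE _ _ _ _ N) //.
    rewrite -(big_mkord xpredT (fun k => c k * ((x * w) ^+ k) p.1)) scaler_suml.
    over.
  rewrite -big_seq [RHS]exchange_big; apply: eq_bigr => i _.
  under [RHS]eq_bigr do rewrite scaler_sumr; rewrite [RHS]exchange_big.
  under [RHS]eq_bigr do
    (under eq_bigr do rewrite scaler_sumr; rewrite exchange_big).
  rewrite [RHS]exchange_big; apply: eq_bigr => j _.
  apply: eq_bigr => k _; rewrite ?fpsME mulr_sumr scaler_suml.
  by apply: eq_bigr => p _; rewrite scalerA mulrA.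
rewrite (@oconv_genE _ _ _ _ N) //.
transitivity (\sum_(0 <= j < N) \sum_(0 <= k < N)
    \sum_(0 <= i < N | (i <= j)%N && (i <= k)%N)
      (c i * (w ^+ j * x ^+ k) m) *: V (k - i)%N (j - i)%N).
  rewrite [LHS]big_nat [RHS]big_nat; apply: eq_bigr => j /andP[_ ltj].
  apply: eq_bigr => k _; rewrite CA scaler_sumr.
  rewrite (big_nat_widen _ _ N) //; last by rewrite (leq_ltn_trans (geq_minl _ _)).
  by apply: eq_big => [i|i _]; rewrite ?ltnS ?leq_min // scalerA mulrC.
transitivity (\sum_(0 <= i < N) \sum_(0 <= j < N | (i <= j)%N)
    \sum_(0 <= k < N | (i <= k)%N)
      (c i * (w ^+ j * x ^+ k) m) *: V (k - i)%N (j - i)%N).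
  under eq_bigr do (under eq_bigr do rewrite big_mkcond; rewrite exchange_big).
  rewrite exchange_big; apply: eq_bigr => i _.
  rewrite [RHS]big_mkcond; apply: eq_bigr => j _.
  by case: ifP => _; [rewrite [RHS]big_mkcond | rewrite big1].
(* Exponents from [N] on contribute nothing at [m], so the ranges keep the bound [N] after the
   shift. *)
have w0 j k : (N <= j)%N -> (w ^+ j * x ^+ k) m = 0.
  by move=> leNj; apply: fps_ordgeMl leNj; apply: fps_ordgeX.
have x0 j k : (N <= k)%N -> (w ^+ j * x ^+ k) m = 0.
  by move=> leNk; rewrite mulrC; apply: fps_ordgeMl leNk; apply: fps_ordgeX.
apply: eq_bigr => i _; rewrite sum_nat_shift; last first.
  by move=> j leNj; apply: big1 => k _; rewrite w0 ?mulr0 ?scale0r.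
apply: eq_bigr => j _; rewrite sum_nat_shift; last first.
  by move=> k leNk; rewrite x0 ?mulr0 ?scale0r.
apply: eq_bigr => k _; rewrite !addnK; congr ((c i * fps_coef _ m) *: _).
by rewrite !exprD exprMn; ring.
Qed.

End GeneratingOperators.

(** * Products of one-variable series *)

Section TupleSeries.
Context {K : comNzRingType} {I : choiceType} {E : lmodType K}.
Local Notation S := (fps I K).
Implicit Types (A C : nat -> E -> E).

(** The first variable gives the rightmost factor because [apply_seq] applies the head of the list
    first. *)
Fixpoint gens A l : ('I_l -> S) -> opser K I E :=
  if l is l'.+1 then
    fun X => oconv (gens A (fun i : 'I_l' => X (lift ord0 i))) (gen A (X ord0))
  else fun=> oscal 1.

Lemma linser_gens A l (X : 'I_l -> S) :
  (forall k, linear (A k)) -> linser (gens A X).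
Proof.
move=> linA; elim: l X => [|l IHl] X; first exact: linser_oscal.
by apply: linser_oconv; [apply: IHl | apply: linser_gen].
Qed.

Lemma ocomm_gen_gens A C l (X : 'I_l -> S) w g :
    (forall k, linear (A k)) -> (forall k, linear (C k)) ->
    (forall i, ocomm (gen C w) (gen A (X i)) (g i)) ->
  ocomm (gen C w) (gens A X) (\prod_i g i).
Proof.
move=> linA linC; elim: l X g => [|l IHl] X g comm_g.
  by rewrite big_ord0; apply: ocomm_scal1r; apply: linser_gen.
rewrite big_ord_recl mulrC.
apply: ocomm_convr; try exact: linser_gen; first exact: linser_gens.
  by apply: IHl => i; apply: comm_g.
exact: comm_g.
Qed.

(** Every factor of [gens C W] crosses every factor of [gens A X] once. Induction on the number of
    [W], with [ocomm_gen_gens] for one crossing factor. *)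
Lemma ocomm_gens A C l l' (X : 'I_l -> S) (W : 'I_l' -> S) g :
    (forall k, linear (A k)) -> (forall k, linear (C k)) ->
    (forall k i, ocomm (gen C (W k)) (gen A (X i)) (g i k)) ->
  ocomm (gens C W) (gens A X) (\prod_i \prod_k g i k).
Proof.
move=> linA linC; elim: l' W g => [|l' IHl] W g comm_g.
  rewrite big1 => [|i _]; last by rewrite big_ord0.
  by apply: ocomm_scal1l; apply: linser_gens.
under eq_bigr do rewrite big_ord_recl mulrC; rewrite big_split.
apply: ocomm_convl; try exact: linser_gens; first exact: linser_gen.
  by apply: IHl => k i; apply: comm_g.
by apply: ocomm_gen_gens => // i; apply: comm_g.
Qed.

End TupleSeries.

(** A finite window for sums over exponent tuples: a tuple outside it has an entry at least [N], so
    in series without constant term its monomial has order at least [N]. *)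
Fixpoint box_tuples (N l : nat) : seq (l.-tuple nat) :=
  if l is l'.+1 then
    [seq cons_tuple k a | k <- iota 0 N, a <- box_tuples N l']
  else [:: [tuple]].

Lemma mem_box_tuples N l (a : l.-tuple nat) :
  (a \in box_tuples N l) = all (fun k => k < N)%N a.
Proof.
elim: l a => [|l IHl] a; first by rewrite tuple0 inE eqxx.
case/tupleP: a => k a; rewrite /= -IHl.
apply/allpairsP/andP => [[[k' a'] /= [+ + /(congr1 val)[-> /val_inj->]]]|[kN aN]].
  by rewrite mem_iota.
by exists (k, a); rewrite mem_iota.
Qed.

Lemma box_tuples_uniq N l : uniq (box_tuples N l).
Proof.
elim: l => [//|l IHl]; apply: allpairs_uniq; rewrite ?iota_uniq //.
by move=> [k a] [k' a'] _ _ /(congr1 val) [-> /val_inj ->].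
Qed.

Lemma fps_ordge_prod_notin (K : comNzRingType) (I : choiceType) N l
    (X : 'I_l -> fps I K) (a : l.-tuple nat) :
  (forall i, fps_ordge 1 (X i)) -> a \notin box_tuples N l ->
  fps_ordge N (\prod_(i < l) X i ^+ tnth a i).
Proof.
move=> X1; rewrite mem_box_tuples => /allPn[_ /tnthP[i ->]]; rewrite -leqNgt.
move=> leN m lt_m; rewrite (bigD1 i) //.
apply: fps_ordgeMl (leq_trans lt_m leN); exact: fps_ordgeX.
Qed.

(** * Matrix coefficients of products as sums over exponent tuples *)

Section FockSeries.
Context {K : fieldType} {I : choiceType}.
Local Notation S := (fps I K).
Local Notation E := (fock K).
Implicit Types (A C : nat -> E -> E).

Lemma linear_apply_seq A s :
  (forall k, linear (A k)) -> linear (apply_seq A s).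
Proof.
by move=> linA; elim: s => [//|k s IHs] a u v; rewrite /= linA IHs.
Qed.

Lemma gensE A l (X : 'I_l -> S) N m v :
    (forall k, linear (A k)) -> (forall i, fps_ordge 1 (X i)) -> (mdeg m < N)%N ->
  gens A X m v = \sum_(a <- box_tuples N l)
    (\prod_(i < l) X i ^+ tnth a i) m *: apply_seq A a v.
Proof.
move=> linA X1; elim: l X X1 m v => [|l IHl] X X1 m v lt_mN.
  by rewrite big_seq1 big_ord0.
rewrite [LHS]/= /oconv big_seq.
transitivity (\sum_(p <- facts m) \sum_(k <- iota 0 N)
    \sum_(a <- box_tuples N l)
      ((X ord0 ^+ k) p.1 * (\prod_(i < l) X (lift ord0 i) ^+ tnth a i) p.2) *:
        apply_seq A (k :: a) v).
  (* The head variable stands on the right in [gens] but on the left in the product of powers, so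
     the two divisors of [m] are exchanged. *)
  rewrite [RHS](facts_swap (fun b c => \sum_(k <- iota 0 N)
    \sum_(a <- box_tuples N l)
      ((X ord0 ^+ k) b * (\prod_(i < l) X (lift ord0 i) ^+ tnth a i) c) *:
        apply_seq A (k :: a) v)) [RHS]big_seq.
  apply: eq_bigr => p /leq_facts[le1 le2].
  rewrite IHl ?(leq_ltn_trans _ lt_mN) // exchange_big; apply: eq_bigr => a _.
  rewrite (@genE _ _ _ _ _ N) ?(leq_ltn_trans _ lt_mN) // /index_iota subn0.
  rewrite linear_raddf_sum ?scaler_sumr; last exact: linear_apply_seq.
  apply: eq_bigr => k _; rewrite linear_scale ?scalerA 1?mulrC //.
  exact: linear_apply_seq.
rewrite [box_tuples N l.+1]/= [RHS]big_allpairs_dep exchange_big.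
apply: eq_bigr => k _.
rewrite exchange_big; apply: eq_bigr => a _.
rewrite big_ord_recl fpsME scaler_suml; apply: eq_bigr => p _.
congr ((_ * fps_coef _ _) *: _).
by apply: eq_bigr => i _; rewrite (tnthS k a).
Qed.

Lemma bracket_ket (v : E) la : bracket v (ket la) = v@_la.
Proof.
rewrite /bracket; under eq_bigr do rewrite mcoeffU mulr_natr mulrb.
rewrite -big_mkcond; have [la_v|la_v] := boolP (la \in msupp v).
  rewrite (big_rem la) //= eqxx big_seq_cond big1 ?addr0 // => nu.
  by rewrite mem_rem_uniq ?fset_uniq // inE eq_sym => /andP[/andP[/negPf->]].
rewrite big_seq_cond big1; first by apply/esym/eqP; rewrite mcoeff_eq0.
by move=> nu /andP[nu_v /eqP e]; rewrite e nu_v in la_v.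
Qed.

(** Serves [F_series] and [G_series] alike. The sign of [Y] in [super_monomial] becomes evaluation
    at [- Y j]. *)
Lemma super_seriesE A C l l' (X : 'I_l -> S) (Y : 'I_l' -> S) u la m :
    (forall k, linear (A k)) -> (forall k, linear (C k)) ->
    (forall i, fps_ordge 1 (X i)) -> (forall j, fps_ordge 1 (Y j)) ->
  fps_sum (fun ab : l.-tuple nat * l'.-tuple nat =>
      bracket (apply_seq A ab.1 (apply_seq C ab.2 u)) (ket la)
        *: super_monomial X Y ab.1 ab.2) m =
  (oconv (gens A X) (gens C (fun j => - Y j)) m u)@_la.
Proof.
move=> linA linC X1 Y1; pose N := (mdeg m).+1.
have Y1' j : fps_ordge 1 (- Y j) by apply: fps_ordgeN.
rewrite [LHS](fsbigE [seq (a, b) | a <- box_tuples N l, b <- box_tuples N l']);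
    first last.
(* Outside the box one of the two tuples has an entry at least [N], so the monomial vanishes at
   [m]. *)
- move=> [a b] _ /negP notin; apply/eqP; rewrite mulf_eq0; apply/orP; right.
  apply/eqP; rewrite /super_monomial.
  have [aN|/fps_ordge_prod_notin a0] := boolP (a \in box_tuples N l).
    have [bN|/fps_ordge_prod_notin b0] := boolP (b \in box_tuples N l').
      by case: notin; apply/allpairsP; exists (a, b).
    by rewrite mulrC; apply: fps_ordgeMl (ltnSn _); apply: b0.
  by apply: fps_ordgeMl (ltnSn _); apply: a0.
- by [].
- by apply: allpairs_uniq; rewrite ?box_tuples_uniq // => -[? ?] [? ?].
under eq_bigl do rewrite in_setT; rewrite big_allpairs.
rewrite /oconv raddf_sum [RHS]big_seq.
under [RHS]eq_bigr => p /leq_facts[le1 le2].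
  rewrite (@gensE _ _ _ N) // (@gensE _ _ _ N) //.
  rewrite raddf_sum.
  over.
rewrite -[RHS]big_seq.
rewrite [RHS]exchange_big; apply: eq_bigr => a _.
transitivity (\sum_(p <- facts m) \sum_(b <- box_tuples N l')
  (\prod_(i < l) X i ^+ tnth a i) p.1 * (\prod_(j < l') (- Y j) ^+ tnth b j) p.2 *
  (apply_seq A a (apply_seq C b u))@_la).
  rewrite exchange_big; apply: eq_bigr => b _.
  by rewrite bracket_ket fpsZE mulrC fpsME mulr_suml.
apply: eq_bigr => p _.
rewrite linear_raddf_sum ?scaler_sumr ?raddf_sum; last exact: linear_apply_seq.
apply: eq_bigr => b _; rewrite linear_scale; last exact: linear_apply_seq.
by rewrite -mulrA -!mcoeffZ.
Qed.

End FockSeries.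

(** * Newton's identity for operators indexed by partitions *)

Section Partitions.

Lemma geq_trans : transitive geq.
Proof. by move=> a b c ab bc; apply: leq_trans bc ab. Qed.

Lemma geq_total : total geq.
Proof. by move=> a b; apply: leq_total. Qed.

Lemma anti_geq : antisymmetric geq.
Proof. by move=> a b; rewrite andbC => /anti_leq. Qed.

Implicit Types (la mu : intpart) (i k : nat).

Lemma intpart_gt0 la i : i \in (la : seq nat) -> (0 < i)%N.
Proof. by case: la => s /= /andP[_ s0] si; case: i si s0 => // ->. Qed.

Lemma perm_intpart la mu : perm_eq la mu -> la = mu.
Proof.
case: la mu => s sP [t tP] /= st.
have [/andP[s_sorted _] /andP[t_sorted _]] := (sP, tP).
by apply/val_inj; apply: (sorted_eq geq_trans anti_geq) st.
Qed.

Fact rem_part_subproof i la : sorted geq (rem i la) && (0%N \notin rem i la).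
Proof.
case: la => s /= /andP[s_sorted s0]; rewrite (contra (@mem_rem _ i s 0%N)) //.
rewrite (subseq_sorted _ (rem_subseq i s)) //; exact: geq_trans.
Qed.

Definition rem_part i la := IntPart (rem_part_subproof i la).

Fact ins_part_subproof i la :
  sorted geq (sort geq (filter (predC1 0%N) (i :: la))) &&
  (0%N \notin sort geq (filter (predC1 0%N) (i :: la))).
Proof.
by rewrite mem_sort mem_filter andbT (sort_sorted geq_total).
Qed.

(** The filter makes insertion total: for [i = 0] it leaves [la] unchanged. *)
Definition ins_part i la := IntPart (ins_part_subproof i la).

Lemma perm_ins_part i la : (0 < i)%N -> perm_eq (ins_part i la) (i :: la).
Proof.
move=> i_gt0; rewrite perm_sort /= -lt0n i_gt0 perm_cons.
by rewrite (all_filterP _) //; apply/allP => j /intpart_gt0; rewrite /= lt0n.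
Qed.

Lemma rem_partK i la : i \in (la : seq nat) -> ins_part i (rem_part i la) = la.
Proof.
move=> i_la; apply: perm_intpart.
rewrite (permPl (perm_ins_part _ (intpart_gt0 i_la))).
by rewrite perm_sym perm_to_rem.
Qed.

Lemma mem_ins_part i la : (0 < i)%N -> i \in (ins_part i la : seq nat).
Proof. by move=> /perm_ins_part/perm_mem->; rewrite mem_head. Qed.

Lemma ins_partK i la : (0 < i)%N -> rem_part i (ins_part i la) = la.
Proof.
move=> i_gt0; apply: perm_intpart; rewrite -(perm_cons i).
by rewrite -(permPl (perm_to_rem (mem_ins_part la i_gt0))) perm_ins_part.
Qed.

Lemma sumn_rem_part i la : i \in (la : seq nat) ->
  (i + sumn (rem_part i la))%N = sumn la.
Proof. by move=> i_la; rewrite (perm_sumn (perm_to_rem i_la)). Qed.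

Lemma sumn_ins_part i la : (0 < i)%N -> sumn (ins_part i la) = (i + sumn la)%N.
Proof. by move=> /perm_ins_part/perm_sumn->. Qed.

(** Strong induction: a nonempty partition arises by inserting its first part into a partition of a
    smaller number. *)
Lemma finite_partitions k : finite_set [set la : intpart | sumn la = k].
Proof.
elim/ltn_ind: k => k IHk.
have [->|k_neq0] := eqVneq k 0%N.
  apply: (@sub_finite_set _ _ [set @IntPart [::] isT]) => // la /= la0.
  apply: perm_intpart; by case: la la0 => -[|[|i] s] //= /andP[_].
apply: (@sub_finite_set _ _ (\bigcup_(i in `I_k)
   (ins_part i.+1 @` [set la : intpart | sumn la = (k - i.+1)%N]))).
  move=> la /= sum_la; case def_la: (parts la) => [|[|i] s].
  - by rewrite -sum_la def_la in k_neq0.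
  - by have := @intpart_gt0 la 0%N; rewrite def_la mem_head => /(_ isT).
  have i_la : i.+1 \in (la : seq nat) by rewrite def_la mem_head.
  have := sumn_rem_part i_la; rewrite sum_la => sum_i.
  exists i; first by rewrite /=; lia.
  by exists (rem_part i.+1 la); [rewrite -sum_i addKn | apply: rem_partK].
apply: bigcup_finite; first exact: finite_II.
by move=> i /= ltik; apply/finite_image/IHk; lia.
Qed.

Definition partitions k := fset_set [set la : intpart | sumn la = k].

Lemma mem_partitions k la : (la \in partitions k) = (sumn la == k).
Proof.
rewrite in_fset_set; last exact: finite_partitions.
by apply/idP/eqP => [/set_mem|?]; last exact/mem_set.
Qed.

(** Inserting [i] is a bijection onto the partitions that have a part [i], with inverse
    [rem_part i]. *)
Lemma sum_partitions_ins (E : nmodType) i k (F : intpart -> E) :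
    (0 < i <= k)%N ->
  \sum_(mu <- partitions (k - i)) F (ins_part i mu) =
  \sum_(la <- partitions k | i \in (la : seq nat)) F la.
Proof.
case/andP=> i_gt0 le_ik; rewrite -(big_map (ins_part i) xpredT F) -[RHS]big_filter.
apply: perm_big; apply: uniq_perm; rewrite ?filter_uniq ?fset_uniq //.
  rewrite map_inj_uniq ?fset_uniq //.
  exact: (can_inj (fun mu => ins_partK mu i_gt0)).
move=> la; rewrite mem_filter mem_partitions.
apply/mapP/andP => [[mu + ->]|[i_la /eqP sum_la]].
  by rewrite mem_partitions mem_ins_part // sumn_ins_part // => /eqP->; split=> //; lia.
exists (rem_part i la); last by rewrite rem_partK.
by rewrite mem_partitions; have := sumn_rem_part i_la; rewrite sum_la; lia.
Qed.

(** Values that do not occur contribute [i ^ 0 * 0! = 1]. This allows comparing [zpart] of a list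
    and of its sublist over one index list. *)
Lemma zpartE (s r : seq nat) : uniq r -> {subset s <= r} ->
  zpart s = (\prod_(i <- r) (i ^ count_mem i s * (count_mem i s)`!))%N.
Proof.
move=> r_uniq sub_sr; rewrite /zpart.
rewrite [RHS](bigID (mem s)) /= [X in (_ * X)%N]big1 ?muln1; last first.
  by move=> i /count_memPn->.
rewrite -[RHS]big_filter; apply: perm_big; apply: uniq_perm.
- exact: undup_uniq.
- exact: filter_uniq.
move=> i; rewrite mem_undup mem_filter /=.
by case: (boolP (i \in s)) => //= /sub_sr.
Qed.

(** Only the factor at [i] changes: for multiplicity [c] it loses one power of [i], and [c!] drops
    to [(c-1)!]. *)
Lemma zpart_rem i (s : seq nat) : i \in s ->
  zpart s = (i * count_mem i s * zpart (rem i s))%N.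
Proof.
move=> i_s; rewrite (@zpartE (rem i s) (undup s)) ?undup_uniq //; last first.
  by move=> j /mem_rem; rewrite mem_undup.
rewrite /zpart !(bigD1_seq i) ?mem_undup ?undup_uniq //=.
have cnt j : count_mem j s = ((i == j) + count_mem j (rem i s))%N.
  by rewrite (permP (perm_to_rem i_s)).
rewrite [in LHS](eq_bigr (fun j =>
  (j ^ count_mem j (rem i s) * (count_mem j (rem i s))`!)%N)); last first.
  by move=> j /negPf neq; rewrite cnt eq_sym neq.
rewrite (cnt i) eqxx add1n factS expnS; ring.
Qed.

Lemma sumn_count k (s : seq nat) : 0%N \notin s -> all (fun i => i <= k)%N s ->
  sumn s = (\sum_(i < k | i.+1 \in s) i.+1 * count_mem i.+1 s)%N.
Proof.
move=> s0 s_le.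
transitivity (\sum_(i < k) i.+1 * count_mem i.+1 s)%N; last first.
  rewrite [RHS]big_mkcond; apply: eq_bigr => i _.
  by case: ifPn => // /count_memPn->; rewrite muln0.
elim: s s0 s_le => [|x s IHs] /=; first by rewrite big1 // => i _; rewrite muln0.
rewrite inE negb_or eq_sym -lt0n => /andP[x_gt0 s0] /andP[x_le s_le].
under eq_bigr do rewrite mulnDr; rewrite big_split /= -IHs //; congr (_ + _)%N.
(* A part [x] is counted at the index [x.-1]. *)
have ltxk : (x.-1 < k)%N by lia.
rewrite (bigD1 (Ordinal ltxk)) //= prednK // eqxx muln1 big1 ?addn0 // => i.
by rewrite -val_eqE /= => neq; case: eqP => [e|_]; rewrite ?muln0 //; lia.
Qed.

End Partitions.

Section CompleteOperators.
Context {K : fieldType} (char0 : forall k, (k.+1)%:R != 0 :> K).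
Local Notation E := (fock K).
Variable b : nat -> E -> E.
Hypothesis b_linear : forall i, linear (b i).

Lemma complete_opE k v :
  complete_op b k v = \sum_(la <- partitions k) (zpart la)%:R^-1 *: part_op b la v.
Proof. by rewrite /complete_op fsbig_finite //; apply: finite_partitions. Qed.

Lemma part_op_linear la : linear (part_op b la).
Proof.
move=> a u v; rewrite /part_op; elim: (parts la) => [//|i s IHs].
by rewrite /= IHs b_linear.
Qed.

Lemma complete_op_linear k : linear (complete_op b k).
Proof.
move=> a u v; rewrite !complete_opE scaler_sumr -big_split /=.
apply: eq_bigr => la _.
by rewrite part_op_linear scalerDr !scalerA mulrC.
Qed.

Lemma complete_op0 v : complete_op b 0 v = v.
Proof.
rewrite complete_opE (perm_big [:: @IntPart [::] isT]) /=.
  by rewrite big_seq1 /zpart big_nil invr1 scale1r.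
apply: uniq_perm; rewrite ?fset_uniq // => la.
rewrite mem_partitions inE; apply/eqP/eqP => [la0|->//].
apply: perm_intpart; by case: la la0 => -[|[|i] s] //= /andP[_].
Qed.

Hypothesis b_comm : forall i j v, (0 < i)%N -> (0 < j)%N ->
  b i (b j v) = b j (b i v).

Lemma part_op_rem i (la : intpart) v : i \in (la : seq nat) ->
  part_op b la v = b i (part_op b (rem_part i la) v).
Proof.
(* The induction runs over plain lists, so the positivity of the parts, required by [b_comm], is
   carried along. *)
rewrite /part_op /=; have := @intpart_gt0 la.
elim: (parts la) => [//|j s IHs] s_gt0; rewrite /= inE.
have [->//|neq /=] := eqVneq j i; rewrite ?(negPf neq) /= => i_s.
rewrite (IHs _ i_s) => [|l l_s]; last by apply: s_gt0; rewrite inE l_s orbT.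
by apply: b_comm; apply: s_gt0; rewrite inE ?eqxx ?i_s ?orbT.
Qed.

(** Write [k] as the sum of [i * m_i] over the distinct parts of each partition. By [zpart_rem] the
    quotient of [i * m_i] by [zpart la] is the inverse of [zpart] of [la] without one part [i], and
    that part supplies the outer mode. *)
Lemma complete_op_newton (k : nat) v :
  k%:R *: complete_op b k v = \sum_(i < k) b i.+1 (complete_op b (k - i.+1) v).
Proof.
rewrite complete_opE scaler_sumr.
transitivity (\sum_(la <- partitions k) \sum_(i < k | i.+1 \in parts la)
    (zpart (rem_part i.+1 la))%:R^-1 *: b i.+1 (part_op b (rem_part i.+1 la) v)).
  rewrite big_seq [RHS]big_seq; apply: eq_bigr => la.
  rewrite mem_partitions => /eqP sum_la.
  rewrite -{1}sum_la (@sumn_count k); first last.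
  - apply/allP => i i_la; rewrite -sum_la -(sumn_rem_part i_la); exact: leq_addr.
  - by apply/negP => /intpart_gt0.
  rewrite natr_sum scaler_suml; apply: eq_bigr => i i_la.
  rewrite (part_op_rem _ i_la) scalerA; congr (_ *: _).
  rewrite (zpart_rem i_la) [X in X^-1]natrM invfM mulrA divff ?mul1r //.
  have : (0 < i.+1 * count_mem i.+1 la)%N by rewrite muln_gt0 -has_count has_pred1.
  by case: (_ * _)%N => // j _; apply: char0.
rewrite (exchange_big_dep xpredT) //=; apply: eq_bigr => i _.
(* Change of variable from [la] with a part [i.+1] to the partition of [k - i.+1] left after
   removing it. *)
rewrite -(@sum_partitions_ins _ i.+1 k (fun la => (zpart (rem_part i.+1 la))%:R^-1
  *: b i.+1 (part_op b (rem_part i.+1 la) v))); last exact: ltn_ord.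
rewrite complete_opE linear_raddf_sum //; apply: eq_bigr => mu _.
by rewrite ins_partK // linear_scale.
Qed.

End CompleteOperators.

Section SignedOperators.
Context {K : comNzRingType} {E : lmodType K}.
Variable b : nat -> E -> E.
Hypothesis b_linear : forall i, linear (b i).

(* With these modes in place of [b], the expansion of [h_k] becomes that of [e_k]. *)
Definition signed_op i v : E := (-1) ^+ i.+1 *: b i v.

Lemma signed_op_linear i : linear (signed_op i).
Proof.
move=> a u v; rewrite /signed_op b_linear scalerDr !scalerA.
by congr (_ *: _ + _); rewrite mulrC.
Qed.

Lemma signed_op_comm i j v : b i (b j v) = b j (b i v) ->
  signed_op i (signed_op j v) = signed_op j (signed_op i v).
Proof.
rewrite /signed_op !(linear_scale _ _ (b_linear _)) => ->.
by rewrite !scalerA mulrC.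
Qed.

End SignedOperators.

(** The global sign distributes over the parts: each part [i] receives [(-1) ^+ i] from the size and
    [-1] from the length. *)
Lemma elementary_opE (K : fieldType) (b : nat -> fock K -> fock K) :
  (forall i, linear (b i)) -> elementary_op b = complete_op (signed_op b).
Proof.
move=> b_linear; apply/funext => k; apply/funext => v.
rewrite /elementary_op /complete_op !fsbig_finite; try exact: finite_partitions.
rewrite scaler_sumr big_seq [RHS]big_seq; apply: eq_bigr => la.
rewrite mem_partitions => /eqP <-; rewrite scalerA mulrA mulrC -scalerA.
congr (_ *: _); rewrite /part_op -exprD.
elim: (parts la) => [|i s IHs] /=; first by rewrite expr0 scale1r.
rewrite /signed_op -IHs (linear_scale _ _ (b_linear _)) scalerA -exprD.
by congr (_ ^+ _ *: _); lia.
Qed.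

(** * Commutation from the Newton recurrences *)

Section HeisenbergCommutation.
Context {K : fieldType} (char0 : forall k, (k.+1)%:R != 0 :> K) {E : lmodType K}.
Implicit Types (b A : nat -> E -> E) (d c : nat -> K).

(** The common properties of the [h_k] and [e_k] operators on which the commutation argument
    rests. *)
Definition newton_family b A :=
  [/\ forall k, linear (A k), forall v, A 0%N v = v &
      forall k v, k%:R *: A k v = \sum_(i < k) b i.+1 (A (k - i.+1)%N v)].

(** The constants [d] are a parameter because signed modes on one side multiply [d j] by
    [(-1) ^+ j.+1]. *)
Definition heisenberg_pair (bA bC : nat -> E -> E) d :=
  forall i j v, (0 < i)%N -> (0 < j)%N ->
    bC j (bA i v) = bA i (bC j v) + (j%:R * d j * (i == j)%:R) *: v.

Lemma heisenberg_pair_signl bA bC d : (forall i, linear (bC i)) ->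
  heisenberg_pair bA bC d ->
  heisenberg_pair (signed_op bA) bC (fun j => (-1) ^+ j.+1 * d j).
Proof.
move=> bC_lin rel i j v i_gt0 j_gt0.
rewrite /signed_op (linear_scale _ _ (bC_lin _)) rel // scalerDr scalerA.
by congr (_ + _ *: _); case: eqP => [->|_]; rewrite ?mulr0 //; ring.
Qed.

Lemma heisenberg_pair_signr bA bC d : (forall i, linear (bA i)) ->
  heisenberg_pair bA bC d ->
  heisenberg_pair bA (signed_op bC) (fun j => (-1) ^+ j.+1 * d j).
Proof.
move=> bA_lin rel i j v i_gt0 j_gt0.
rewrite /signed_op (linear_scale _ _ (bA_lin _)) rel // scalerDr scalerA.
by congr (_ + _ *: _); ring.
Qed.

Section Modes.
Variables (a : nat -> K) (B : int -> E -> E).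
Hypothesis heisenberg : forall (j k : int) v, j != 0 -> k != 0 ->
  B j (B k v) - B k (B j v) = (j%:~R * a `|k|%N * (j == - k)%:R) *: v.

Lemma modes_comm (j k : int) v : j != 0 -> k != 0 -> j != - k ->
  B j (B k v) = B k (B j v).
Proof.
move=> j0 k0 /negPf jk; apply/eqP.
by rewrite -subr_eq0 heisenberg // jk mulr0 scale0r.
Qed.

Lemma heisenberg_pair_modes :
  heisenberg_pair (fun i => B (- i%:Z)) (fun i => B i%:Z) a.
Proof.
move=> i j v i_gt0 j_gt0; have i0 : - i%:Z != 0 by lia.
have j0 : j%:Z != 0 by lia.
rewrite -[LHS](subrK (B (- i%:Z) (B j%:Z v))) heisenberg // addrC.
congr (_ + _ *: _); rewrite abszN absz_nat opprK eqz_nat.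
by case: (eqVneq j i) => [->|]; rewrite ?mulr0.
Qed.

End Modes.

(** In characteristic zero, the coefficients of [exp(sum_i d_i t^i / i)]. *)
Definition newton_scalars d c :=
  c 0%N = 1 /\ forall k, k%:R * c k = \sum_(i < k) d i.+1 * c (k - i.+1)%N.

Variables (bA bC A C : nat -> E -> E) (d c : nat -> K).
Hypothesis bA_linear : forall i, linear (bA i).
Hypothesis bC_linear : forall i, linear (bC i).
Hypothesis bCbA : heisenberg_pair bA bC d.
Hypothesis A_newton : newton_family bA A.
Hypothesis C_newton : newton_family bC C.
Hypothesis c_newton : newton_scalars d c.

Lemma scale_natr_inj k : (0 < k)%N -> injective (fun v : E => k%:R *: v).
Proof. by case: k => // k _; apply: scalerI. Qed.

(** Induction on [k] after multiplying by [k]. In Newton's sum, [bC j] first meets the outer mode,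
    then the inner operator, where the induction hypothesis applies. *)
Lemma newton_comm1 j k v : (0 < j)%N ->
  bC j (A k v) = A k (bC j v) + (if (j <= k)%N then d j *: A (k - j)%N v else 0).
Proof.
case: A_newton => A_linear A0 A_rec j_gt0.
elim/ltn_ind: k v => k IHk v; have [k0|k_gt0] := posnP k.
  by rewrite k0 !A0 leqNgt j_gt0 addr0.
apply: (scale_natr_inj k_gt0); rewrite -linear_scale // A_rec.
rewrite linear_raddf_sum // scalerDr A_rec.
transitivity (\sum_(i < k) (bA i.+1 (A (k - i.+1)%N (bC j v)) +
    (bA i.+1 (if (j <= k - i.+1)%N then d j *: A (k - i.+1 - j)%N v else 0) +
     (j%:R * d j * (i.+1 == j)%:R) *: A (k - i.+1)%N v))).
  apply: eq_bigr => i _; rewrite bCbA // IHk; last by have := ltn_ord i; lia.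
  by rewrite linear_add // addrA.
rewrite !big_split /=; congr (_ + _).
case: ifP => [le_jk|lt_kj]; last first.
  rewrite scaler0 !big1 ?addr0 // => i _.
    by case: eqP => [e|_]; rewrite ?mulr0 ?scale0r //; have := ltn_ord i; lia.
  by case: ifP => [le_j|_]; [lia | apply: linear_zero].
(* Split [k] as [(k - j) + j]: the first part is Newton's sum for [A (k - j)], the second comes from
   the single index with [i.+1 = j]. *)
have -> : k%:R *: (d j *: A (k - j)%N v) =
    d j *: ((k - j)%N%:R *: A (k - j)%N v) + (j%:R * d j) *: A (k - j)%N v.
  by rewrite !scalerA -scalerDl natrB //; congr (_ *: _); ring.
congr (_ + _).
  rewrite A_rec (big_ord_widen k (fun i => bA i.+1 (A (k - j - i.+1)%N v))) ?leq_subr //.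
  rewrite scaler_sumr [RHS]big_mkcond; apply: eq_bigr => i _ /=.
  have -> : (i < k - j)%N = (j <= k - i.+1)%N by have := ltn_ord i; lia.
  case: ifP => _; last exact: linear_zero.
  by rewrite linear_scale //; congr (_ *: bA _ (A _ _)); lia.
have lt_jk : (j.-1 < k)%N by lia.
rewrite (bigD1 (Ordinal lt_jk)) //= prednK // eqxx mulr1 big1 ?addr0 // => i.
rewrite -val_eqE /= => neq; case: eqP => [e|_]; rewrite ?mulr0 ?scale0r //; lia.
Qed.

(** Induction on [j] after multiplying by [j]. Expand [C j] by Newton, apply the induction
    hypothesis, and move the mode inwards by [newton_comm1]. The terms that keep the mode reassemble
    to [(j - i) C (j - i)], the others to [i c i], and the factors add up to [j]. *)
Lemma newton_comm j k v : C j (A k v) =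
  \sum_(0 <= i < (minn j k).+1) c i *: A (k - i)%N (C (j - i)%N v).
Proof.
case: A_newton => A_linear _ _; case: C_newton => C_linear C0 C_rec.
case: c_newton => c0 c_rec.
(* With the bound by [k] turned into a condition, the range depends on [j] alone. *)
have minE j' k' (F : nat -> E) : \sum_(0 <= i < (minn j' k').+1) F i =
    \sum_(0 <= i < j'.+1 | (i <= k')%N) F i.
  rewrite (big_nat_widen _ _ j'.+1) ?ltnS ?geq_minl //.
  rewrite [LHS]big_nat_cond [RHS]big_nat_cond.
  by apply: eq_bigl => i; lia.
rewrite minE; elim/ltn_ind: j v => j IHj v; have [->|j_gt0] := posnP j.
  by rewrite big_mkcond big_nat1 c0 scale1r !subn0 !C0.
apply: (scale_natr_inj j_gt0); rewrite C_rec.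
pose V i := A (k - i)%N (C (j - i)%N v).
transitivity (\sum_(a < j) (\sum_(0 <= i < j.+1 | (i <= k)%N && (i <= j - a.+1)%N)
     c i *: A (k - i)%N (bC a.+1 (C (j - i - a.+1)%N v)) +
   \sum_(0 <= i < j.+1 | (i <= k)%N && (i <= j - a.+1)%N)
     if (a.+1 <= k - i)%N then (d a.+1 * c i) *: V (i + a.+1)%N else 0)).
  apply: eq_bigr => a _; have lt_aj := ltn_ord a.
  rewrite IHj; last by lia.
  rewrite linear_raddf_sum // -big_split /=.
  rewrite (big_nat_widen _ _ j.+1) ?ltnS ?leq_subr //; apply: eq_big => // i _.
  rewrite linear_scale // newton_comm1 // scalerDr; congr (_ *: A _ (bC _ (C _ v)) + _).
    lia.
  case: ifP => _; rewrite ?scaler0 // scalerA mulrC /V.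
  by congr (_ *: A _ (C _ v)); lia.
rewrite big_split scaler_sumr /=.
transitivity (\sum_(0 <= i < j.+1 | (i <= k)%N)
  (((j - i)%N%:R * c i) *: V i + (i%:R * c i) *: V i)); last first.
  rewrite [LHS]big_nat_cond [RHS]big_nat_cond.
  apply: eq_bigr => i /andP[/andP[_ le_ij] _].
  by rewrite -scalerDl scalerA -mulrDl -natrD subnK.
rewrite big_split; congr (_ + _).
  rewrite (exchange_big_dep (fun i => i <= k)%N) /=; last by move=> a i _ /andP[].
  rewrite [LHS]big_nat_cond [RHS]big_nat_cond.
  apply: eq_bigr => i /andP[/andP[_ le_ij] le_ik].
  rewrite mulrC -scalerA /V -(linear_scale _ _ (A_linear _)) C_rec.
  rewrite (big_ord_widen j (fun a => bC a.+1 (C (j - i - a.+1)%N v))) ?leq_subr //.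
  rewrite linear_raddf_sum // scaler_sumr; apply: eq_bigl => a.
  by have := ltn_ord a; rewrite le_ik; lia.
transitivity (\sum_(0 <= i < j.+1 | (i <= k)%N) \sum_(a < j | (a < i)%N)
    (d a.+1 * c (i - a.+1)%N) *: V i); last first.
  rewrite [LHS]big_nat_cond [RHS]big_nat_cond.
  apply: eq_bigr => i /andP[/andP[_ le_ij] le_ik].
  rewrite c_rec (big_ord_widen j (fun a => d a.+1 * c (i - a.+1)%N)) //.
  by rewrite scaler_suml.
rewrite [RHS](exchange_big_dep xpredT) //=.
apply: eq_bigr => a _; have lt_aj := ltn_ord a.
(* Extended by zero beyond [j] and [k], the summand can be shifted by [a.+1] without changing the
   range. *)
pose F i := if (i <= k)%N && (i <= j)%N then (d a.+1 * c (i - a.+1)%N) *: V i else 0.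
transitivity (\sum_(0 <= i < j.+1) F (i + a.+1)%N).
  rewrite big_mkcond; apply: eq_bigr => i _; rewrite /F addnK.
  by rewrite -if_and; congr (if _ then _ else _); lia.
rewrite -sum_nat_shift => [|i lt_ji]; last by rewrite /F [(i <= j)%N]leqNgt lt_ji andbF.
rewrite [LHS]big_nat_cond [RHS]big_nat_cond /F.
under eq_bigr => i /andP[/andP[_ lt_ij] _] do rewrite -[(i <= j)%N]ltnS lt_ij andbT.
rewrite -big_mkcondr; apply: eq_bigl => i; lia.
Qed.

End HeisenbergCommutation.

(** * Newton's identities for symmetric functions *)

Section SymmetricNewton.
Context {K : comNzRingType}.
Local Notation M := {cmonom nat}.
Local Notation S := (fps nat K).
Implicit Types (m : M) (f : S).

Definition ucm_exp (x k : nat) : M := [cmonom k | _ in [fset x]%fset]%M.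

Lemma ucm_expE x k y : ucm_exp x k y = (k * (y == x))%N.
Proof. by rewrite cmE fsfun_fun in_fset1; case: eqP; rewrite (muln1, muln0). Qed.

Lemma ucm_exp_div m x k : (k <= m x)%N -> (ucm_exp x k * divcm m (ucm_exp x k))%M = m.
Proof.
move=> le_kx; apply/eqP/cmP => y; rewrite cmM divcmE ucm_expE subnKC //.
by case: eqP => [->|_]; rewrite (muln1, muln0).
Qed.

Lemma mdeg_ucm_exp x k : mdeg (ucm_exp x k) = k.
Proof.
rewrite (mdegEw (d := [fset x]%fset)) ?big_seq_fset1 ?ucm_expE ?eqxx ?muln1 //.
apply/fsubsetP => y; rewrite -cmE_neq0 ucm_expE in_fset1.
by case: (eqVneq y x) => //= _; rewrite muln0.
Qed.

(** The monomials of a power sum are powers of single variables, and such a power divides [m]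
    exactly when the exponent of its variable in [m] exceeds [k]. *)
Lemma psum_mulE k f m :
  ((psum K k.+1 : S) * f) m =
  \sum_(x <- finsupp m | (k < m x)%N) f (divcm m (ucm_exp x k.+1)).
Proof.
pose is_power (u : M) := (mdeg u == k.+1) &&
  `[< exists x, forall y, u y = (k.+1 * (y == x))%N >].
have is_powerP u : reflect (exists x, u = ucm_exp x k.+1) (is_power u).
  apply: (iffP andP) => [[_ /asboolP[x ux]]|[x ->]].
    by exists x; apply/eqP/cmP => y; rewrite ucm_expE.
  split; first by rewrite mdeg_ucm_exp.
  by apply/asboolP; exists x => y; rewrite ucm_expE.
transitivity (\sum_(p <- facts m | is_power p.1) f p.2).
  rewrite fpsME [RHS]big_mkcond; apply: eq_bigr => p _.
  by rewrite /= -/(is_power _); case: (is_power _); rewrite (mul1r, mul0r).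
pose h x := (ucm_exp x k.+1, divcm m (ucm_exp x k.+1)).
rewrite -[LHS]big_filter -[RHS]big_filter.
rewrite -[RHS](big_map h xpredT (fun p => f p.2)).
apply: perm_big; apply: uniq_perm.
- by rewrite filter_uniq ?fset_uniq.
- rewrite map_inj_uniq ?filter_uniq ?fset_uniq // => x y [/(congr1 (fun u : M => u x))].
  by rewrite !ucm_expE eqxx muln1; case: eqP => //; rewrite muln0.
move=> [u w]; rewrite mem_filter factorizationsP /=.
apply/andP/mapP => [[/is_powerP[x ->] /eqP def_m]|[x + [-> ->]]].
  exists x; last first.
    rewrite /h -def_m; congr (_, _); apply/eqP/cmP => y.
    by rewrite divcmE cmM addKn.
  rewrite mem_filter -def_m -cmE_neq0 cmM ucm_expE eqxx muln1; lia.
rewrite mem_filter => /andP[lt_k _]; split; last by rewrite ucm_exp_div.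
by apply/is_powerP; exists x.
Qed.

Lemma mdeg_div_ucm_exp m x k n : (k < m x)%N -> (k < n)%N ->
  (mdeg (divcm m (ucm_exp x k.+1)) == n - k.+1)%N = (mdeg m == n).
Proof.
move=> lt_k lt_kn; have /(congr1 mdeg) := ucm_exp_div lt_k.
by rewrite mdegM mdeg_ucm_exp => <-; lia.
Qed.

Lemma leq_mdeg m x : (m x <= mdeg m)%N.
Proof.
have [x_m|] := boolP (x \in finsupp m); last by rewrite -cmE_eq0 => /eqP->.
by rewrite mdegE (big_rem x) //= leq_addr.
Qed.

Lemma hsymE k m : hsym K k m = (mdeg m == k)%:R.
Proof. by rewrite /= asboolT // andbT. Qed.

Lemma symfun_coef_sum k (F : 'I_k -> symfun K) m :
  (\sum_(i < k) F i : symfun K) m = \sum_(i < k) F i m.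
Proof. exact: (big_morph (fun g : symfun K => g m)). Qed.

Lemma symfun_coefZ a (g : symfun K) m : (a *: g) m = a * g m.
Proof. by []. Qed.

Lemma psum_coef_mulE k (g : symfun K) m : (psum K k.+1 * g) m =
  \sum_(x <- finsupp m | (k < m x)%N) g (divcm m (ucm_exp x k.+1)).
Proof. by rewrite -psum_mulE. Qed.

Lemma card_ord_lt n k : (n <= k)%N -> (\sum_(i < k | i < n) 1 = n)%N.
Proof. by move=> le_nk; rewrite -(big_ord_widen k (fun=> 1%N)) // sum1_card card_ord. Qed.

(** At [m] of degree [k] a variable [x] contributes once for each [i < m x], and the exponents add
    up to [k]. *)
Lemma hsym_newton k :
  k%:R *: hsym K k = \sum_(i < k) psum K i.+1 * hsym K (k - i.+1).
Proof.
apply/val_inj/fpsP => m; rewrite symfun_coef_sum symfun_coefZ hsymE.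
under eq_bigr do rewrite psum_coef_mulE.
transitivity (\sum_(i < k) \sum_(x <- finsupp m | (i < m x)%N) (mdeg m == k)%:R : K);
    last first.
  apply: eq_bigr => i _; apply: eq_bigr => x lt_i.
  by rewrite hsymE mdeg_div_ucm_exp.
have [deg_m|_] := eqVneq; last by rewrite mulr0 !big1 // => i _; rewrite big1.
rewrite mulr1 (exchange_big_dep xpredT) //= -{1}deg_m mdegE natr_sum.
apply: eq_bigr => x _; have := leq_mdeg m x; rewrite deg_m => /card_ord_lt {1}<-.
by rewrite natr_sum.
Qed.

Definition sqfree m := `[< forall x, (m x <= 1)%N >].

Lemma esymE k m : Defs.esym K k m = ((mdeg m == k) && sqfree m)%:R.
Proof. by []. Qed.

Lemma sqfree_div m x k : (k < m x)%N ->
  sqfree (divcm m (ucm_exp x k.+1)) =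
  `[< forall y, y != x -> (m y <= 1)%N >] && (m x <= k.+2)%N.
Proof.
move=> lt_k; apply/asboolP/andP => [sf|[/asboolP off le_x] y].
  split; last by have := sf x; rewrite divcmE ucm_expE eqxx muln1; lia.
  by apply/asboolP => y /negPf neq; have := sf y; rewrite divcmE ucm_expE neq muln0 subn0.
rewrite divcmE ucm_expE; have [->|/off] := eqVneq y x; last by rewrite muln0 subn0.
by rewrite muln1; lia.
Qed.

(* Removing a power of [x] from [m] leaves a squarefree monomial for two
   consecutive exponents, which cancel, unless [x] has exponent one in [m]. *)
Lemma sqfree_div_sum m x k : (0 < m x <= k)%N ->
  \sum_(i < k | (i < m x)%N)
    (-1) ^+ i * (sqfree (divcm m (ucm_exp x i.+1)))%:R = (sqfree m)%:R :> K.
Proof.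
case/andP=> mx_gt0 le_k.
transitivity (\sum_(i < m x) (-1) ^+ i *
  (`[< forall y, y != x -> (m y <= 1)%N >] && (m x <= i.+2)%N)%:R : K).
  rewrite (big_ord_widen k (fun i => (-1) ^+ i *
    (`[< forall y, y != x -> (m y <= 1)%N >] && (m x <= i.+2)%N)%:R : K)) //.
  by apply: eq_bigr => i lt_i; rewrite sqfree_div.
have -> : sqfree m = `[< forall y, y != x -> (m y <= 1)%N >] && (m x <= 1)%N.
  apply/asboolP/andP => [sf|[/asboolP off le1] y].
    by split=> //; apply/asboolP => y _.
  by have [->|/off] := eqVneq y x.
case: asboolP => _ /=; last by rewrite big1 // => i _; rewrite mulr0.
case: (m x) mx_gt0 => [//|[|n]] _; first by rewrite big_ord1 mulr1.
rewrite !big_ord_recr /= ltnSn ltnS leqW ?leqnn // big1 ?add0r => [|i _].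
  by rewrite !mulr1 exprS mulN1r addrN.
by rewrite leqNgt !ltnS ltn_ord mulr0.
Qed.

(** By [sqfree_div_sum] each variable of [m] contributes one if [m] is squarefree and zero
    otherwise; a squarefree monomial of degree [k] has [k] variables. *)
Lemma esym_newton k : k%:R *: Defs.esym K k =
  \sum_(i < k) (-1) ^+ i *: (psum K i.+1 * Defs.esym K (k - i.+1)).
Proof.
apply/val_inj/fpsP => m; rewrite symfun_coef_sum symfun_coefZ esymE.
under eq_bigr do rewrite symfun_coefZ psum_coef_mulE mulr_sumr.
transitivity (\sum_(i < k) \sum_(x <- finsupp m | (i < m x)%N)
    (mdeg m == k)%:R * ((-1) ^+ i * (sqfree (divcm m (ucm_exp x i.+1)))%:R) : K);
    last first.
  apply: eq_bigr => i _; apply: eq_bigr => x lt_i.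
  by rewrite esymE mdeg_div_ucm_exp // -mulnb natrM mulrCA.
have [deg_m|_] := eqVneq; last first.
  by rewrite mulr0 big1 // => i _; rewrite big1 // => x _; rewrite mul0r.
rewrite (exchange_big_dep xpredT) //=.
transitivity (\sum_(x <- finsupp m) (sqfree m)%:R : K); last first.
  rewrite big_seq [RHS]big_seq; apply: eq_bigr => x; rewrite -cmE_neq0 -lt0n => mx_gt0.
  rewrite -(@sqfree_div_sum m x k); last by rewrite mx_gt0 -deg_m leq_mdeg.
  by apply: eq_bigr => i _; rewrite mul1r.
rewrite /sqfree; case: asboolP => [sf|_]; last by rewrite mulr0 big1.
rewrite mulr1 -deg_m mdegE natr_sum [LHS]big_seq [RHS]big_seq.
apply: eq_bigr => x.
by rewrite -cmE_neq0; have := sf x; case: (m x) => [//|[|]].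
Qed.

Lemma fps1E m : (1 : S) m = (m == 1%M)%:R.
Proof. by []. Qed.

Lemma hsym0 : hsym K 0 = 1.
Proof.
apply/val_inj; rewrite rmorph1; apply: fpsP => m.
by rewrite [LHS]hsymE [RHS]fps1E mdeg_eq0.
Qed.

Lemma esym0 : Defs.esym K 0 = 1.
Proof.
apply/val_inj; rewrite rmorph1; apply: fpsP => m; rewrite [LHS]esymE [RHS]fps1E mdeg_eq0.
have -> : (m == 1%M) && sqfree m = (m == 1%M).
  have [->|//] := eqVneq m 1%M; rewrite /sqfree asboolT // => x.
  by rewrite cm1.
by [].
Qed.

End SymmetricNewton.

(** * The Cauchy identity *)

Section Pairing.
Context {K : fieldType} {I : choiceType}.
Local Notation E := (fock K).

Lemma fock_expand (D : {fset intpart}) (v : E) : (msupp v `<=` D)%fset ->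
  v = \sum_(la <- D) v@_la *: ket la.
Proof.
move=> /monalgEw {1}->; apply: eq_bigr => la _.
by apply/malgP => nu; rewrite mcoeffZ !mcoeffU mulr_natr.
Qed.

(* Inserting the identity [\sum_la |la><la|] between two operator series. *)
Lemma pairing_sum (T T' : opser K I E) (f g : intpart -> fps I K) v nu :
    linser T' ->
    (forall la m, f la m = (T m v)@_la) ->
    (forall la m, g la m = (T' m (ket la))@_nu) ->
  fps_summable (fun la => f la * g la) /\
  forall m, fps_sum (fun la => f la * g la) m = (oconv T' T m v)@_nu.
Proof.
move=> linT' fE gE.
(* Only partitions in the support of some [T p.1 v] contribute at [m]; their finiteness gives
   summability. *)
pose D m : {fset intpart} := (\bigcup_(p <- facts m) msupp (T p.1 v))%fset.
have sub_D m p : p \in facts m -> (msupp (T p.1 v) `<=` D m)%fset.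
  by move=> pm; apply: (bigfcup_sup _ pm).
have coefE la m : (f la * g la) m =
    \sum_(p <- facts m) (T p.1 v)@_la * (T' p.2 (ket la))@_nu.
  by rewrite fpsME; apply: eq_bigr => p _; rewrite fE gE.
have coef0 la m : la \notin D m -> (f la * g la) m = 0.
  move=> la_D; rewrite coefE big_seq big1 // => p /sub_D/fsubsetP sub_p.
  by rewrite mcoeff_outdom ?mul0r //; apply: contra la_D => /sub_p.
split=> m.
  apply: (@sub_finite_set _ _ [set` D m]); last exact: finite_fset.
  by move=> la nz; apply: contraNT nz => /coef0 fg0; apply/eqP.
rewrite [LHS](fsbigTE (D m)) => [|la /coef0 //].
under eq_bigr do rewrite coefE.
rewrite exchange_big /oconv.
(* The coefficient of [T] takes the first divisor in [f la * g la], the second in [oconv T' T]. *)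
rewrite (facts_swap (fun a b => T' a (T b v))) raddf_sum.
rewrite [LHS]big_seq [RHS]big_seq; apply: eq_bigr => p /sub_D sub_p.
rewrite {2}(fock_expand sub_p) linear_raddf_sum // raddf_sum.
by apply: eq_bigr => la _; rewrite linear_scale // -mcoeffZ.
Qed.

End Pairing.

(** Regroups the factors of [Omega] into the two involving [W] and the two involving [Z]. *)
Lemma mulr4ADCB (R : comPzRingType) (x y z t : R) :
  x * y * z * t = x * t * (z * y).
Proof. by rewrite -mulrA mulrACA [RHS]mulrACA [t * y]mulrC. Qed.

Section SuperCauchy.
Context {K : fieldType} (char0 : forall k, (k.+1)%:R != 0 :> K).
Local Notation E := (fock K).
Implicit Types (b bA bC A C : nat -> E -> E) (d c : nat -> K).

Lemma newton_complete b : (forall i, linear (b i)) ->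
    (forall i j v, (0 < i)%N -> (0 < j)%N -> b i (b j v) = b j (b i v)) ->
  newton_family b (complete_op b).
Proof.
move=> b_lin b_comm; split; [exact: complete_op_linear|exact: complete_op0|].
exact: complete_op_newton.
Qed.

Lemma newton_elementary b : (forall i, linear (b i)) ->
    (forall i j v, (0 < i)%N -> (0 < j)%N -> b i (b j v) = b j (b i v)) ->
  newton_family (signed_op b) (elementary_op b).
Proof.
move=> b_lin b_comm; rewrite elementary_opE //.
apply: newton_complete; first exact: signed_op_linear.
by move=> i j v i_gt0 j_gt0; apply: signed_op_comm => //; apply: b_comm.
Qed.

Variables (a : nat -> K) (B : int -> {linear E -> E}).
Hypothesis heisenberg : forall (j k : int) v, j != 0 -> k != 0 ->
  B j (B k v) - B k (B j v) = (j%:~R * a `|k|%N * (j == - k)%:R) *: v.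
Variable kappa : {lrmorphism symfun K -> K^o}.
Hypothesis kappa_psum : forall k, (0 < k)%N -> kappa (psum K k) = a k.

Let raising (i : nat) : E -> E := B (- i%:Z).
Let lowering (i : nat) : E -> E := B i%:Z.

Let raising_linear i : linear (raising i).
Proof. by move=> c u v; rewrite /raising linearP. Qed.

Let lowering_linear i : linear (lowering i).
Proof. by move=> c u v; rewrite /lowering linearP. Qed.

Let raising_comm i j v : (0 < i)%N -> (0 < j)%N ->
  raising i (raising j v) = raising j (raising i v).
Proof.
move=> i_gt0 j_gt0; rewrite /raising (modes_comm (B := fun i => B i) heisenberg) //; lia.
Qed.

Let lowering_comm i j v : (0 < i)%N -> (0 < j)%N ->
  lowering i (lowering j v) = lowering j (lowering i v).
Proof.
move=> i_gt0 j_gt0; rewrite /lowering (modes_comm (B := fun i => B i) heisenberg) //; lia.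
Qed.

Let raising_lowering : heisenberg_pair raising lowering a.
Proof. exact: (heisenberg_pair_modes (B := fun i => B i) heisenberg). Qed.

(** The image of Newton's identity under the ring morphism [kappa]. *)
Lemma kappa_hsym_newton : newton_scalars a (fun k => kappa (hsym K k)).
Proof.
split=> [|k]; first by rewrite hsym0 rmorph1.
have := congr1 kappa (hsym_newton (K := K) k); rewrite linearZ raddf_sum /= => e.
apply: etrans e _; apply: eq_bigr => i _; by rewrite rmorphM /= kappa_psum.
Qed.

Lemma kappa_esym_newton :
  newton_scalars (fun j => (-1) ^+ j.+1 * a j) (fun k => kappa (Defs.esym K k)).
Proof.
split=> [|k]; first by rewrite esym0 rmorph1.
have := congr1 kappa (esym_newton (K := K) k); rewrite linearZ raddf_sum /= => e.
apply: etrans e _; apply: eq_bigr => i _; rewrite linearZ rmorphM /= kappa_psum //.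
by rewrite !exprS !mulN1r opprK; apply: mulrA.
Qed.

Context {I : choiceType} {nX nY nW nZ : nat}.
Variables (X : 'I_nX -> fps I K) (Y : 'I_nY -> fps I K).
Variables (W : 'I_nW -> fps I K) (Z : 'I_nZ -> fps I K).
Hypothesis X1 : forall i, fps_ordge 1 (X i).
Hypothesis Y1 : forall j, fps_ordge 1 (Y j).
Hypothesis W1 : forall k, fps_ordge 1 (W k).
Hypothesis Z1 : forall l, fps_ordge 1 (Z l).

Let Useries : opser K I E :=
  oconv (gens (U_op B) X) (gens (Ut_op B) (fun j => - Y j)).
Let Dseries : opser K I E :=
  oconv (gens (D_op B) W) (gens (Dt_op B) (fun l => - Z l)).

Let U_newton : newton_family raising (U_op B).
Proof. by apply: newton_complete => //; apply: raising_comm. Qed.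
Let Ut_newton : newton_family (signed_op raising) (Ut_op B).
Proof. by apply: newton_elementary => //; apply: raising_comm. Qed.
Let D_newton : newton_family lowering (D_op B).
Proof. by apply: newton_complete => //; apply: lowering_comm. Qed.
Let Dt_newton : newton_family (signed_op lowering) (Dt_op B).
Proof. by apply: newton_elementary => //; apply: lowering_comm. Qed.

Let U_linear k : linear (U_op B k). Proof. by case: U_newton. Qed.
Let Ut_linear k : linear (Ut_op B k). Proof. by case: Ut_newton. Qed.
Let D_linear k : linear (D_op B k). Proof. by case: D_newton. Qed.
Let Dt_linear k : linear (Dt_op B k). Proof. by case: Dt_newton. Qed.

Let U_gens : linser (gens (U_op B) X) := linser_gens X U_linear.
Let Ut_gens : linser (gens (Ut_op B) (fun j => - Y j)) := linser_gens _ Ut_linear.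
Let D_gens : linser (gens (D_op B) W) := linser_gens W D_linear.
Let Dt_gens : linser (gens (Dt_op B) (fun l => - Z l)) := linser_gens _ Dt_linear.
Let U_series : linser Useries := linser_oconv U_gens Ut_gens.
Let D_series : linser Dseries := linser_oconv D_gens Dt_gens.

Lemma ocomm_newton bA bC A C d c w x :
    (forall i, linear (bA i)) -> (forall i, linear (bC i)) ->
    heisenberg_pair bA bC d -> newton_family bA A -> newton_family bC C ->
    newton_scalars d c -> fps_ordge 1 w -> fps_ordge 1 x ->
  ocomm (gen C w) (gen A x) (fps_sum (fun k : nat => c k *: (x * w) ^+ k) : fps I K).
Proof.
move=> bA_lin bC_lin rel newA newC newc w1 x1; apply: ocomm_gen => //.
- by case: newA.
- by case: newC.
by move=> j k v; exact: (newton_comm char0 bA_lin bC_lin rel newA newC newc).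
Qed.

(** Series of the same type have constants [a] and give [H_kernel]; series of opposite types have
    signed constants and give [E_kernel]. *)
Lemma ocomm_Omega : ocomm Dseries Useries (Omega kappa X Y W Z).
Proof.
have Y1' j : fps_ordge 1 (- Y j) by apply: fps_ordgeN.
have Z1' l : fps_ordge 1 (- Z l) by apply: fps_ordgeN.
have sr_lin i : linear (signed_op raising i) by apply: signed_op_linear.
have sl_lin i : linear (signed_op lowering i) by apply: signed_op_linear.
have rel := raising_lowering.
have relA := heisenberg_pair_signl lowering_linear rel.
have relC := heisenberg_pair_signr raising_linear rel.
(* With both mode families signed the two signs cancel. *)
have relAC : heisenberg_pair (signed_op raising) (signed_op lowering) a.
  have := heisenberg_pair_signr sr_lin relA; congr heisenberg_pair.
  by apply/funext => j; rewrite mulrA -expr2 sqrr_sign mul1r.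
have DU := ocomm_gens U_linear D_linear (fun k i => ocomm_newton raising_linear
  lowering_linear rel U_newton D_newton kappa_hsym_newton (W1 k) (X1 i)).
have DUt := ocomm_gens Ut_linear D_linear (fun k j => ocomm_newton sr_lin
  lowering_linear relA Ut_newton D_newton kappa_esym_newton (W1 k) (Y1' j)).
have DtU := ocomm_gens U_linear Dt_linear (fun l i => ocomm_newton raising_linear
  sl_lin relC U_newton Dt_newton kappa_esym_newton (Z1' l) (X1 i)).
have DtUt := ocomm_gens Ut_linear Dt_linear (fun l j => ocomm_newton sr_lin
  sl_lin relAC Ut_newton Dt_newton kappa_hsym_newton (Z1' l) (Y1' j)).
(* One sign survives in the mixed factors; two cancel in those for [Y] and [Z]. *)
have EYW : \prod_j \prod_k E_kernel kappa (- Y j * W k) =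
    \prod_j \prod_k E_kernel kappa (- (Y j * W k)).
  by do 2![apply: eq_bigr => ? _]; rewrite mulNr.
have EXZ : \prod_i \prod_l E_kernel kappa (X i * - Z l) =
    \prod_i \prod_l E_kernel kappa (- (X i * Z l)).
  by do 2![apply: eq_bigr => ? _]; rewrite mulrN.
have HYZ : \prod_j \prod_l H_kernel kappa (- Y j * - Z l) =
    \prod_j \prod_l H_kernel kappa (Y j * Z l).
  by do 2![apply: eq_bigr => ? _]; rewrite mulrNN.
have comm := ocomm_convl D_gens Dt_gens U_series
  (ocomm_convr U_gens Ut_gens D_gens DU DUt)
  (ocomm_convr U_gens Ut_gens Dt_gens DtU DtUt).
rewrite /Omega mulr4ADCB -HYZ -EYW -EXZ; exact: comm.
Qed.

Lemma super_cauchy (mu nu : intpart) :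
  let lhs la := F_series B la mu X Y * G_series B la nu W Z in
  let rhs la := F_series B nu la X Y * G_series B mu la W Z in
  [/\ fps_summable lhs, fps_summable rhs &
      fps_sum lhs = Omega kappa X Y W Z * fps_sum rhs].
Proof.
move=> lhs rhs.
have FE la ka m : F_series B la ka X Y m = (Useries m (ket ka))@_la.
  exact: super_seriesE.
have GE la ka m : G_series B la ka W Z m = (Dseries m (ket la))@_ka.
  exact: super_seriesE.
have [sum_lhs lhsE] := pairing_sum D_series (fun la => FE la mu) (fun la => GE la nu).
(* Here the lowering series acts first, so [G_series] takes the first place and the product is
   commuted to match [rhs]. *)
have [] := pairing_sum U_series (fun la => GE mu la) (fun la => FE nu la).
have -> : (fun la => G_series B mu la W Z * F_series B nu la X Y) = rhs.
  by apply/funext => la; rewrite mulrC.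
move=> sum_rhs rhsE; split; [exact: sum_lhs|exact: sum_rhs|]; apply: fpsP => m.
rewrite lhsE ocomm_Omega /oconv fpsME raddf_sum; apply: eq_bigr => p _.
by rewrite rhsE -mcoeffZ.
Qed.

End SuperCauchy.

Lemma Cq_char0 (R : realType) k : (k.+1)%:R != 0 :> Cq R.
Proof.
rewrite -(rmorph_nat (@tofrac {poly R[i]})) tofrac_eq0 -polyC_natr polyC_eq0.
by rewrite Num.Theory.pnatr_eq0.
Qed.

Theorem theorem3p2 (R : realType) (n : nat) (n_gt0 : (0 < n)%N)
    (B : int -> {linear fock (Cq R) -> fock (Cq R)})
    (B_LLT : LLT_representation B (q_var R) n)
    (kappa : {lrmorphism symfun (Cq R) -> (Cq R)^o})
    (kappa_psum : forall k, (0 < k)%N ->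
       kappa (psum (Cq R) k) = heis_coef (q_var R) n k)
    (mu nu : intpart) (nX nY nW nZ : nat) :
  let V : choiceType := ('I_nX + 'I_nY + 'I_nW + 'I_nZ)%type in
  let X i : fps V (Cq R) := fps_var (inl (inl (inl i))) in
  let Y j : fps V (Cq R) := fps_var (inl (inl (inr j))) in
  let W k : fps V (Cq R) := fps_var (inl (inr k)) in
  let Z l : fps V (Cq R) := fps_var (inr l) in
  let lhs la := F_series B la mu X Y * G_series B la nu W Z in
  let rhs la := F_series B nu la X Y * G_series B mu la W Z in
  [/\ fps_summable lhs, fps_summable rhs &
      fps_sum lhs = Omega kappa X Y W Z * fps_sum rhs].
Proof.
move=> V X Y W Z.
(* Each variable is a series without constant term. *)
apply: (super_cauchy (@Cq_char0 R) (heisenberg_relation B_LLT) kappa_psum) => i;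
  exact: fps_ordge_var.
Qed.
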